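(* Given a connected graph $G$ and a vertex $x \in V(G)$, a maximum $x$-position set of $G$ can be computed in $O(n m \log(n^2/m))$ time, where $n = |V(G^*_x)|$ and $m = |E(G^*_x)|$.
   Context: All graphs are finite, undirected and simple. A $u,v$-geodesic is a shortest $u,v$-path. For a vertex $x$ of $G$, a set $S \subseteq V(G)$ is an $x$-position set if for every $y \in S$ no vertex of $S \setminus \{y\}$ lies on any $x,y$-geodesic in $G$; a maximum $x$-position set is one of largest cardinality. The reduced graph $\widetilde{G}_x$ is the graph on vertex set $V(G)$ obtained from $G$ by removing all edges connecting vertices at the same distance from $x$. The graph $G^*_x$ is the graph on vertex set $V(G)$ obtained from $\widetilde{G}_x$ by adding an edge between any two vertices that lie on a common geodesic to $x$. *)

(* Defs.v *)
From mathcomp Require Import all_boot.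
From mathcomp Require Import boolp.

Set Implicit Arguments.
Unset Strict Implicit.
Unset Printing Implicit Defensive.

(** * Graphs

    A simple graph is a symmetric irreflexive relation [e] on a [finType]. *)

Section Graphs.
Variables (T : finType) (e : rel T).
Implicit Types (u v w x y : T) (p q : seq T) (S : {set T}).

(* The path has vertex sequence [u :: p] and length [size p]. *)
Definition is_path u v p : bool :=
  [&& path e u p, last u p == v & uniq (u :: p)].

Definition geodesic u v p : Prop :=
  is_path u v p /\ forall q, is_path u v q -> size p <= size q.

(* Paths are duplicate-free, hence of length less than [#|T|]; the value is
   [#|T|] when [v] is not reachable from [u]. *)
Definition dist u v : nat :=
  find (fun k => `[< exists2 p, is_path u v p & size p = k >]) (iota 0 #|T|).

Definition position_set x S : Prop :=
  forall y, y \in S -> forall z, z \in S :\ y ->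
  forall p, geodesic x y p -> z \notin x :: p.

Definition maximum_position_set x S : Prop :=
  position_set x S /\ forall S', position_set x S' -> #|S'| <= #|S|.

Definition reduced_graph x : rel T :=
  fun u v => e u v && (dist x u != dist x v).

Definition star_graph x : rel T :=
  fun u v => reduced_graph x u v
    || (u != v) &&
       `[< exists y p, [/\ geodesic y x p, u \in y :: p & v \in y :: p] >].

Definition edge_set : {set {set T}} := [set [set u; v] | u in T, v in T & e u v].

End Graphs.

(** * Random access machine

    A word RAM with structured control flow.  Programs are finite syntax trees
    independent of the input; every operation, test and assignment has unit
    cost.  All words are required to be smaller than a bound [W]: evaluating
    an expression with an intermediate value outside this range is a fault and
    has no execution.  There are a register file, addressed by constants only,
    and a memory, addressed by computed words. *)

Inductive binop := Add | Sub | Mul | Eq | Lt.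

Inductive expr :=
  | Lit of nat
  | Reg of nat
  | Read of expr
  | Op of binop & expr & expr.

Inductive cmd :=
  | Skip
  | SetReg of nat & expr
  | SetMem of expr & expr
  | Seq of cmd & cmd
  | If of expr & cmd & cmd
  | While of expr & cmd.

Record state := State { reg : nat -> nat; memory : nat -> nat }.

Definition binop_sem (o : binop) (a b : nat) : nat :=
  match o with
  | Add => a + b
  | Sub => a - b
  | Mul => a * b
  | Eq => a == b
  | Lt => a < b
  end.

Definition word (W k : nat) : option nat := if k < W then Some k else None.

Fixpoint eval (W : nat) (s : state) (a : expr) : option nat :=
  match a with
  | Lit k => word W k
  | Reg r => word W (reg s r)
  | Read b => obind (fun i => word W (memory s i)) (eval W s b)
  | Op o b c =>
      obind (fun i => obind (fun j => word W (binop_sem o i j)) (eval W s c))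
            (eval W s b)
  end.

Fixpoint cost (a : expr) : nat :=
  match a with
  | Lit _ | Reg _ => 1
  | Read b => (cost b).+1
  | Op _ b c => (cost b + cost c).+1
  end.

Definition set_reg (s : state) (r k : nat) : state :=
  State [eta reg s with r |-> k] (memory s).

Definition set_mem (s : state) (i k : nat) : state :=
  State (reg s) [eta memory s with i |-> k].

(* [exec W c s t s']: started in [s], the program [c] halts in [s'] after time
   [t], without fault.  A test succeeds when its value is nonzero. *)
Inductive exec (W : nat) : cmd -> state -> nat -> state -> Prop :=
  | ExecSkip s : exec W Skip s 1 s
  | ExecSetReg s r a k :
      eval W s a = Some k ->
      exec W (SetReg r a) s (cost a).+1 (set_reg s r k)
  | ExecSetMem s a b i k :
      eval W s a = Some i -> eval W s b = Some k ->
      exec W (SetMem a b) s (cost a + cost b).+1 (set_mem s i k)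
  | ExecSeq c1 c2 s1 s2 s3 t1 t2 :
      exec W c1 s1 t1 s2 -> exec W c2 s2 t2 s3 ->
      exec W (Seq c1 c2) s1 (t1 + t2) s3
  | ExecIf a c1 c2 s s' k t :
      eval W s a = Some k -> exec W (if k != 0 then c1 else c2) s t s' ->
      exec W (If a c1 c2) s ((cost a).+1 + t) s'
  | ExecWhileFalse a c s :
      eval W s a = Some 0 -> exec W (While a c) s (cost a).+1 s
  | ExecWhileTrue a c s1 s2 s3 k t1 t2 :
      eval W s1 a = Some k -> k != 0 ->
      exec W c s1 t1 s2 -> exec W (While a c) s2 t2 s3 ->
      exec W (While a c) s1 ((cost a).+1 + t1 + t2) s3.

(** * Input and output conventions *)

(* Words below [c * n ^ c] have O(log n) bits. *)
Definition word_bound (c n : nat) : nat := c * n ^ c.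

(* Register 0 holds the number of vertices and register 1 the vertex [x]; the
   memory holds the adjacency matrix in row-major order.  All other registers
   and cells are 0. *)
Definition input (n : nat) (e : rel 'I_n) (x : 'I_n) : state :=
  State (fun r => nth 0 [:: n; nat_of_ord x] r)
        (fun k => [exists i : 'I_n, exists j : 'I_n, (k == i * n + j) && e i j]).

(* A set is returned as its characteristic vector in cells 0, ..., n - 1. *)
Definition output (n : nat) (s : state) : {set 'I_n} :=
  [set v : 'I_n | memory s v != 0].

(* Main.v *)
(** Say that [z] is below [w] when [z] lies on a geodesic from [x] to [w] and
    [z <> w].  This is a strict order whose antichains are the [x]-position sets
    and whose comparable pairs are edges of [star_graph].  A maximum antichain
    comes from a maximum matching of the bipartite graph joining each vertex to
    the vertices below it (Dilworth's theorem via Koenig's).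

    Augmenting paths find the matching in time O(n(n + m)).  The order itself
    costs O(n^2 + nm): going down the levels of a breadth-first search, each edge
    between consecutive levels copies one row of the order matrix.  Since [x] is
    below every other vertex, [n - 1 <= m], so everything is O(nm); since
    [m <= n^2 / 2], the factor [ln (n^2 / m)] is at least [ln 2] and only helps.

    The matching is computed by repeated searches from all unmatched vertices at
    once.  The vertices reached by the last, unsuccessful, search give the Koenig
    antichain directly, so it is not necessary to show that a vertex with no
    augmenting path never gets one later. *)

Require Import Defs.
From mathcomp Require Import all_boot all_order all_algebra.
From mathcomp Require Import boolp zify reals exp.

Set Implicit Arguments.
Unset Strict Implicit.
Unset Printing Implicit Defensive.

(** * Geodesics and the order below a vertex *)

(** A search costs O(n + m), because it scans lists of lower vertices instead of matrix rows and
    queues a vertex at most once. Each successful search matches one more vertex, so there are at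
    most n + 1 searches. Optimality is certified by counting: an antichain has at most as many
    elements as there are unmatched upper vertices, and the set read off the last search has at
    least as many. Alternating paths never occur as objects, only the marks left by a search and
    their closure properties. The main burden is the machine. Execution is a relation with explicit
    time and with faults, so correctness, termination, time and word size have to be proved
    together. The program logic carries the clock through the postconditions, and one bound on all
    stored values excludes faults once and for all. *)

Section GeodesicOrder.
Variables (T : finType) (e : rel T) (x : T).
Hypotheses (e_sym : symmetric e) (e_irr : irreflexive e).
Hypothesis e_conn : forall u v, connect e u v.

Definition level v := dist e x v.

(** The reduced graph with its edges oriented away from [x]; by [geodesicP] its directed paths from
    [x] are the geodesics. *)
Definition down_edge u v := e u v && (level v == (level u).+1).

Definition below z w := (z != w) && connect down_edge z w.

Lemma level_le_path p : path e x p -> level (last x p) <= size p.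
Proof.
move=> px; rewrite /level /dist leqNgt; apply/negP => lt.
case/shortenP: px lt => q qx uq qp lt.
have szq : size q <= size p by apply: uniq_leq_size => //; case/andP: uq.
have szq' : (size q).+1 <= #|T| by have/card_uniqP /= <- := uq; exact: max_card.
have := @before_find _ 0 _ (iota 0 #|T|) (size q) (leq_ltn_trans szq lt).
rewrite nth_iota // add0n => /negP; apply; apply/asboolP.
by exists q => //; rewrite /is_path qx eqxx uq.
Qed.

Lemma level_path v :
  exists p, is_path e x v p /\ size p = level v.
Proof.
have [p px ->] := connectP (e_conn x v).
case/shortenP: px => q qx uq qp.
have szq : (size q).+1 <= #|T| by have/card_uniqP /= <- := uq; exact: max_card.
pose a k := `[< exists2 p, is_path e x (last x q) p & size p = k >].
have aq : has a (iota 0 #|T|).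
  apply/hasP; exists (size q); first by rewrite mem_iota.
  by apply/asboolP; exists q => //; rewrite /is_path qx eqxx uq.
have := nth_find 0 aq; rewrite nth_iota; last by move: aq; rewrite has_find size_iota.
by rewrite add0n => /asboolP [r rx sr]; exists r.
Qed.

Lemma level_lt v : level v < #|T|.
Proof.
have [p [/and3P [_ _ up] <-]] := level_path v.
by have/card_uniqP /= <- := up; exact: max_card.
Qed.

Lemma level_root : level x = 0.
Proof. by apply/eqP; rewrite -leqn0; exact: (@level_le_path [::]). Qed.

Lemma level_edge u v : e u v -> level v <= (level u).+1.
Proof.
move=> uv; have [p [/and3P [px /eqP pu _] <-]] := level_path u.
have := @level_le_path (rcons p v).
by rewrite rcons_path px pu uv last_rcons size_rcons; exact.
Qed.

Lemma path_down_level u p :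
  path down_edge u p -> level (last u p) = level u + size p.
Proof.
elim: p u => [|v p IH] u /=; first by rewrite addn0.
by case/andP=> /andP [_ /eqP lv] /IH ->; rewrite lv addSnnS.
Qed.

(** An edge raises the level by at most one, so a path from [x] ends at level [size p] only if every
    edge raises it. *)
Lemma path_down p :
  path down_edge x p = path e x p && (size p == level (last x p)).
Proof.
elim/last_ind: p => [|p v IH]; first by rewrite level_root.
rewrite !rcons_path last_rcons size_rcons IH /down_edge.
have [px|] //= := boolP (path e x p).
have [uv|] := boolP (e (last x p) v); last by rewrite andbF.
have l1 := level_le_path px; have l2 := level_edge uv; lia.
Qed.

Lemma path_down_uniq p : path down_edge x p -> uniq (x :: p).
Proof.
move=> pd; apply: (@map_uniq _ _ level).
apply: (sorted_uniq ltn_trans ltnn) => /=.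
by elim: p (x) pd => //= u p IH y /andP [/andP [_ /eqP yu] /IH ->]; rewrite yu ltnSn.
Qed.

Lemma geodesicP y p :
  geodesic e x y p <-> path down_edge x p /\ last x p = y.
Proof.
split=> [[/and3P [px /eqP py up] min]|[pd py]].
  split=> //; rewrite path_down px py /= eqn_leq -{2}py level_le_path // andbT.
  by have [q [qy <-]] := level_path y; exact: min.
have := pd; rewrite path_down => /andP [px /eqP sp].
split=> [|q /and3P [qx /eqP qy _]].
  by rewrite /is_path px py eqxx path_down_uniq.
by rewrite sp py -qy level_le_path.
Qed.

Lemma connect_down_level z w : connect down_edge z w -> level z <= level w.
Proof. by case/connectP=> p pd ->; rewrite path_down_level // leq_addr. Qed.

Lemma below_level z w : below z w -> level z < level w.
Proof.
case/andP=> zw /connectP [[|u p] pd lw]; first by rewrite /= in lw; rewrite lw eqxx in zw.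
by rewrite lw path_down_level //= addnS ltnS leq_addr.
Qed.

Lemma below_trans : transitive below.
Proof.
move=> w z y zw wy; have zy := ltn_trans (below_level zw) (below_level wy).
rewrite /below; apply/andP; split; first by apply: contraTneq zy => ->; rewrite ltnn.
by case/andP: zw => _ /connect_trans; apply; case/andP: wy.
Qed.

(** The recurrence evaluated by the program: row [w] of the order matrix is the union, over the down
    edges from [u] to [w], of [u] itself and row [u]. *)
Lemma belowP z w :
  reflect (exists u, down_edge u w /\ (z = u \/ below z u)) (below z w).
Proof.
apply: (iffP idP) => [/andP [zw /connectP [p]]|[u [uw zu]]].
  case/lastP: p => [|p v]; first by move=> _ wz; rewrite wz eqxx in zw.
  rewrite rcons_path last_rcons => /andP [pd uv] ->; exists (last z p); split=> //.
  have [<-|nz] := eqVneq z (last z p); first by left.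
  by right; rewrite /below nz; apply/connectP; exists p.
have zu' : connect down_edge z u by case: zu => [->|/andP []].
have zw := connect_trans zu' (connect1 uw).
rewrite /below zw andbT; apply/eqP => zw'; have := connect_down_level zu'.
by case/andP: uw => _ /eqP; rewrite -zw' => ->; rewrite ltnn.
Qed.

Lemma level_parent v : v != x -> exists u, down_edge u v.
Proof.
move=> vx; have [p [/and3P [px /eqP pv _] sp]] := level_path v.
have : path down_edge x p by rewrite path_down px pv sp eqxx.
case/lastP: p pv {px sp} => [/= xv|p w]; first by rewrite xv eqxx in vx.
rewrite last_rcons rcons_path => -> /andP [_ wv].
by exists (last x p).
Qed.

Lemma connect_down_root v : connect down_edge x v.
Proof.
have [p [/and3P [px /eqP pv _] sp]] := level_path v.
by apply/connectP; exists p => //; rewrite path_down px pv sp eqxx.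
Qed.

Lemma below_root v : v != x -> below x v.
Proof. by move=> vx; rewrite /below eq_sym vx connect_down_root. Qed.

Lemma below_geodesic z w :
  below z w <-> z != w /\ exists2 p, geodesic e x w p & z \in x :: p.
Proof.
split=> [/andP [zw /connectP [q qd qw]]|[zw [p /geodesicP [pd pw] zp]]].
  split=> //; have /connectP [p pd pz] := connect_down_root z.
  exists (p ++ q); first by apply/geodesicP; rewrite cat_path pd -pz last_cat -pz.
  by rewrite -cat_cons mem_cat pz mem_last.
rewrite /below zw; case/splitPl: zp pd pw => p1 p2 pz.
rewrite cat_path last_cat pz => /andP [_ p2d] p2w.
by apply/connectP; exists p2.
Qed.

Lemma position_setP S :
  position_set e x S <-> {in S &, forall z y, ~~ below z y}.
Proof.
split=> [pos z y zS yS|anti y yS z].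
  apply/negP => /below_geodesic [zy [p gp zp]].
  have zSy : z \in S :\ y by rewrite !inE zy.
  by have := pos y yS z zSy p gp; rewrite zp.
rewrite !inE => /andP [zy zS] p gp; apply: contraNN (anti z y zS yS) => zp.
by apply/below_geodesic; split=> //; exists p.
Qed.

(** [star_graph] speaks of geodesics to [x], [position_set] of geodesics from [x]; reversal links
    the two. *)
Lemma is_path_rev u v p : is_path e u v p ->
  exists q, [/\ is_path e v u q, size q = size p & v :: q =i u :: p].
Proof.
case/and3P=> up /eqP lp uq; exists (rev (belast u p)).
have e1 : v :: rev (belast u p) = rev (u :: p) by rewrite [u :: p]lastI rev_rcons lp.
split; last by move=> y; rewrite e1 mem_rev.
  rewrite /is_path e1 rev_uniq uq -{1}lp rev_path andbT.
  rewrite (eq_path (e' := e)) ?up; last by move=> a b; rewrite e_sym.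
  apply/eqP; rewrite -[LHS]/(last v (v :: rev (belast u p))) e1.
  by rewrite rev_cons last_rcons.
by rewrite size_rev size_belast.
Qed.

Lemma below_star z w : below z w -> star_graph e x z w.
Proof.
case/below_geodesic=> zw [p [pw min] zp].
apply/orP; right; rewrite zw; apply/asboolP.
have [q [qx sq qp]] := is_path_rev pw.
exists w, q; rewrite !qp zp; split=> //; last first.
  by case/and3P: pw => _ /eqP <- _; exact: mem_last.
split=> // r /is_path_rev [r' [r'w <- _]]; rewrite sq; exact: min.
Qed.

Let m := #|edge_set (star_graph e x)|.

(** Comparable vertices have different levels, so an ordered pair can be recovered from the
    unordered edge and no edge is counted twice. *)
Lemma card_below_le : \sum_w #|[set z | below z w]| <= m.
Proof.
pose P := [set p : T * T | below p.1 p.2].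
have -> : \sum_w #|[set z | below z w]| = #|P|.
  rewrite -sum1_card; under eq_bigr do rewrite -sum1_card.
  rewrite (exchange_big_dep xpredT) //= pair_big_dep /=.
  by apply: eq_bigl => p; rewrite !inE.
have injP : {in P &, injective (fun p : T * T => [set p.1; p.2])}.
  move=> [a b] [c d]; rewrite !inE /= => ab cd eq.
  have: a \in [set c; d] by rewrite -eq !inE eqxx.
  have: b \in [set c; d] by rewrite -eq !inE eqxx orbT.
  have: c \in [set a; b] by rewrite eq !inE eqxx.
  have ab' := below_level ab; have cd' := below_level cd.
  rewrite !inE.
  by move=> /orP [] /eqP ? /orP [] /eqP ? /orP [] /eqP ?; subst => //; lia.
rewrite -(card_in_imset injP); apply: subset_leq_card.
apply/subsetP => A /imsetP [[a b]]; rewrite inE /= => ab -> {A}.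
by apply/imset2P; exists a b => //; rewrite !inE /= below_star.
Qed.

Lemma card_pred_le : #|T|.-1 <= m.
Proof.
apply: leq_trans card_below_le.
rewrite -(cardC1 x) -sum1_card big_mkcond /=.
apply: leq_sum => w _; rewrite !inE; case: ifP => // wx.
by rewrite card_gt0; apply/set0Pn; exists x; rewrite inE below_root.
Qed.

Lemma card_star_le : m.*2 <= #|T| ^ 2.
Proof.
have le : m <= 'C(#|T|, 2).
  rewrite -card_draws; apply: subset_leq_card; apply/subsetP => A.
  case/imset2P=> u v _ /[!inE] /= uv ->; rewrite cards2.
  suff -> : u != v by [].
  apply: contraTneq uv => ->.
  by rewrite /star_graph /reduced_graph e_irr !eqxx.
rewrite -leq_double in le; apply: leq_trans le _.
rewrite bin2 -mul2n; have := leq_mul (leqnn #|T|) (leq_pred #|T|).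
by case: #|T| => // k; rewrite -mulnn; lia.
Qed.

End GeodesicOrder.

(** * Antichains and matchings *)

Section AntichainDuality.
Variables (T : finType) (lt : rel T) (f : T -> option T).
Hypothesis lt_trans : transitive lt.
Hypothesis f_lt : forall w z, f w = Some z -> lt z w.
Hypothesis f_inj : forall w w' z, f w = Some z -> f w' = Some z -> w = w'.

Let unmatched := [set w | f w == None].

(* In the lower closure of [S] the matched elements inject, via [f], into those
   strictly below [S], so at least [#|S|] elements are unmatched there. *)
Lemma antichain_le_unmatched (S : {set T}) :
  {in S &, forall z y, ~~ lt z y} -> #|S| <= #|unmatched|.
Proof.
move=> anti; pose B := [set v | [exists s in S, lt v s]].
have SB0 : [disjoint S & B].
  rewrite disjoint_subset; apply/subsetP => v vS; rewrite !inE.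
  by apply/exists_inPn => s sS; exact: anti.
have le : #|(S :|: B) :\: unmatched| <= #|B|.
  rewrite -(card_in_imset (f := f)); last first.
    move=> w w'; rewrite !inE; case fw: (f w) => [z|] //= _ _ fw'.
    exact: f_inj fw (esym fw').
  rewrite -(card_imset B Some_inj); apply: subset_leq_card.
  apply/subsetP => _ /imsetP [w] /[!inE] /andP [fw wSB] ->.
  case ef: (f w) fw => [z|] // _; apply: imset_f; rewrite inE.
  have zw := f_lt ef; case/orP: wSB => [wS|/exists_inP [s sS ws]].
    by apply/exists_inP; exists w.
  by apply/exists_inP; exists s => //; exact: lt_trans ws.
have := cardsID unmatched (S :|: B).
have /eqP := (leq_card_setU S B).2; rewrite SB0.
have := subset_leq_card (subsetIr (S :|: B) unmatched); lia.
Qed.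

Variable Z : {set T}.
Hypothesis Z_matched : forall z, z \in Z -> exists w, f w = Some z.

(** Koenig's cover: [Z] consists of the lower copies and [ZL] of the upper copies reached from
    unmatched upper copies. The upper copies outside [ZL] and the lower copies in [Z] cover all
    comparable pairs, and [ZL :\: Z] is the set of elements with neither copy in the cover. *)
Let ZL := [set w | if f w is Some z then z \in Z else true].

Hypothesis Z_closed : forall w z, w \in ZL -> lt z w -> z \in Z.

Lemma koenig_antichain : {in ZL :\: Z &, forall z y, ~~ lt z y}.
Proof.
move=> z y; rewrite in_setD => /andP [zZ _]; rewrite in_setD => /andP [_ yZL].
by apply: contra zZ; exact: Z_closed.
Qed.

(** Every element of [Z] is the mate of a matched element of [ZL], so removing [Z] costs at most as
    much as the matched part contributes. *)
Lemma koenig_card : #|unmatched| <= #|ZL :\: Z|.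
Proof.
pose Y := [set w | if f w is Some z then z \in Z else false].
have ZLE : #|unmatched| + #|Y| = #|ZL|.
  rewrite -cardsUI [X in _ + X](_ : _ = 0) ?addn0.
    by apply: eq_card => w; rewrite !inE; case: (f w).
  by apply/eqP; rewrite cards_eq0; apply/eqP/setP => w; rewrite !inE; case: (f w).
have ZY : #|Z| <= #|Y|.
  rewrite -(card_imset Z Some_inj).
  apply: leq_trans (leq_imset_card f _); apply: subset_leq_card.
  apply/subsetP => _ /imsetP [z zZ ->]; have [w fw] := Z_matched zZ.
  by apply/imsetP; exists w; rewrite ?inE fw.
have := cardsID Z ZL; have := subset_leq_card (subsetIr ZL Z); lia.
Qed.

End AntichainDuality.

(** * A program logic for the machine *)

(* While registers and cells hold values below [4 * n ^ 2], the value of [a] is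
   below [expr_coef a * n ^ expr_degree a], so evaluation cannot fault. *)
Fixpoint expr_coef (a : expr) : nat :=
  match a with
  | Lit k => k.+1
  | Reg _ => 4
  | Read b => 4 + expr_coef b
  | Op Mul b c => expr_coef b * expr_coef c
  | Op _ b c => expr_coef b + expr_coef c
  end.

Fixpoint expr_degree (a : expr) : nat :=
  match a with
  | Lit _ => 0
  | Reg _ => 2
  | Read b => 2 + expr_degree b
  | Op _ b c => expr_degree b + expr_degree c
  end.

(** A generous bound on the expressions of the program; the constant 1000 reappears as the word
    bound in the theorem. *)
Definition small_expr a := (expr_coef a <= 1000) && (expr_degree a <= 1000).

(** Registers 0 and 2 may not be assigned, because [ev] takes their values to be [n] and [n * n]. *)
Fixpoint straight (c : cmd) : bool :=
  match c with
  | Skip => true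
  | SetReg r a => [&& r != 0, r != 2 & small_expr a]
  | SetMem a b => small_expr a && small_expr b
  | Seq c1 c2 => straight c1 && straight c2
  | If a c1 c2 => [&& small_expr a, straight c1 & straight c2]
  | While _ _ => false
  end.

Definition For (r : nat) (b : expr) (c : cmd) : cmd :=
  Seq (SetReg r (Lit 0))
    (While (Op Lt (Reg r) b) (Seq c (SetReg r (Op Add (Reg r) (Lit 1))))).

Section ProgramLogic.
Variables n W : nat.
Hypothesis n_gt0 : 0 < n.
Hypothesis W_large : forall c d, c <= 1000 -> d <= 1000 -> c * n ^ d <= W.

(** Register 2 holds [n * n] and everything else that is stored is at most [n + 1]. Addresses are
    larger, but they occur only as intermediate values. *)
Definition maxval := n * n + n + 1.

Definition ok s :=
  [/\ reg s 0 = n, reg s 2 = n * n, forall r, reg s r <= maxval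
    & forall i, memory s i <= maxval].

(** A total version of [eval]. Registers 0 and 2 are replaced by their known values so that
    addresses simplify to the form [n * n + (8 * i + k)] used in all invariants. *)
Fixpoint ev (s : state) (a : expr) : nat :=
  match a with
  | Lit k => k
  | Reg 0 => n
  | Reg 2 => n * n
  | Reg r => reg s r
  | Read b => memory s (ev s b)
  | Op o b c => binop_sem o (ev s b) (ev s c)
  end.

Lemma expr_coef_gt0 a : 0 < expr_coef a.
Proof.
elim: a => //= [o b IHb c IHc]; case: o; rewrite ?addn_gt0 ?IHb //.
by rewrite muln_gt0 IHb.
Qed.

Lemma leq_coef c1 d1 c2 d2 :
  c1 <= c2 -> d1 <= d2 -> c1 * n ^ d1 <= c2 * n ^ d2.
Proof. by move=> c12 d12; apply: leq_mul => //; rewrite leq_pexp2l. Qed.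

Lemma maxval_lt : maxval < 4 * n ^ 2.
Proof.
rewrite /maxval -mulnn; have := leq_mul n_gt0 n_gt0.
by have := leq_mul (leqnn n) n_gt0; lia.
Qed.

Lemma ev_lt s a : ok s -> ev s a < expr_coef a * n ^ expr_degree a.
Proof.
case=> [r0 r2 rB mB].
have lt4 k : k <= maxval -> k < 4 * n ^ 2 by move=> /leq_ltn_trans; apply; exact: maxval_lt.
elim: a => [k|r|b IH|o b IHb c IHc].
- by rewrite /= expn0 muln1.
- have -> : ev s (Reg r) = reg s r by case: r => [|[|[|r]]] /=; rewrite ?r0 ?r2.
  exact: lt4.
- apply: leq_trans (lt4 _ (mB _)) _; apply: leq_coef => /=; lia.
- have gb := expr_coef_gt0 b; have gc := expr_coef_gt0 c.
  have nb : 0 < n ^ expr_degree b by rewrite expn_gt0 n_gt0.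
  have nc : 0 < n ^ expr_degree c by rewrite expn_gt0 n_gt0.
  rewrite [expr_degree _]/= expnD; set P := n ^ _ in IHb nb *; set Q := n ^ _ in IHc nc *.
  have lin : ev s b + ev s c < (expr_coef b + expr_coef c) * (P * Q).
    have h1 : expr_coef b * P <= expr_coef b * (P * Q).
      by rewrite leq_mul2l leq_pmulr ?orbT.
    have h2 : expr_coef c * Q <= expr_coef c * (P * Q).
      by rewrite leq_mul2l leq_pmull ?orbT.
    by rewrite mulnDl; lia.
  have two : 1 < (expr_coef b + expr_coef c) * (P * Q).
    by have := leq_mul (leq_add gb gc) (leq_mul nb nc); lia.
  case: o => //=.
  + exact: leq_ltn_trans (leq_trans (leq_subr _ _) (leq_addr _ _)) lin.
  + by rewrite mulnACA ltn_mul.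
  + exact: leq_ltn_trans (leq_b1 _) two.
  + exact: leq_ltn_trans (leq_b1 _) two.
Qed.

Lemma eval_ev s a : ok s -> small_expr a -> eval W s a = Some (ev s a).
Proof.
move=> oks.
have wE b k : ev s b = k -> small_expr b -> word W k = Some k.
  move=> <- /andP [cb db]; rewrite /word ifT //.
  exact: leq_trans (ev_lt _ oks) (W_large cb db).
elim: a => [k|r|b IH|o b IHb c IHc] sm.
- exact: (wE (Lit k)).
- have rE : ev s (Reg r) = reg s r.
    by case: oks => r0 r2 _ _; case: r {sm} => [|[|[|r]]] /=; rewrite ?r0 ?r2.
  by rewrite rE /= (wE (Reg r)).
- have smb : small_expr b by move: sm; rewrite /small_expr /=; lia.
  by rewrite /= IH //= (wE (Read b)).
- have gb := expr_coef_gt0 b; have gc := expr_coef_gt0 c.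
  have cbc : expr_coef b <= expr_coef (Op o b c) /\ expr_coef c <= expr_coef (Op o b c).
    by case: o {sm} => /=; rewrite ?leq_addl ?leq_addr // leq_pmulr // leq_pmull.
  have smb : small_expr b by move: sm; rewrite /small_expr; case: cbc => [] /=; lia.
  have smc : small_expr c by move: sm; rewrite /small_expr; case: cbc => [] /=; lia.
  by rewrite /= IHb //= IHc //= (wE (Op o b c)).
Qed.

(** Total correctness: a fault-free halting execution exists. The postcondition sees the absolute
    clock, which lets loop invariants state time bounds. *)
Definition run (c : cmd) (Q : nat -> state -> Prop) (t : nat) (s : state) :=
  exists t' s', [/\ exec W c s t' s', ok s' & Q (t + t') s'].

Lemma run_weaken c (Q Q' : nat -> state -> Prop) t s :
  (forall t' s', ok s' -> Q t' s' -> Q' t' s') -> run c Q t s -> run c Q' t s.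
Proof. by move=> QQ' [t' [s' [ex oks /QQ' Qs]]]; exists t', s'; split; auto. Qed.

Fixpoint wp (c : cmd) (Q : nat -> state -> Prop) (t : nat) (s : state) : Prop :=
  match c with
  | Skip => Q (t + 1) s
  | SetReg r a => ev s a <= maxval /\ Q (t + (cost a).+1) (set_reg s r (ev s a))
  | SetMem a b => ev s b <= maxval /\
      Q (t + (cost a + cost b).+1) (set_mem s (ev s a) (ev s b))
  | Seq c1 c2 => wp c1 (wp c2 Q) t s
  | If a c1 c2 => (ev s a != 0 -> wp c1 Q (t + (cost a).+1) s) /\
      (ev s a = 0 -> wp c2 Q (t + (cost a).+1) s)
  | While _ _ => False
  end.

Lemma run_seq c1 c2 Q t s :
  run c1 (fun t' s' => ok s' -> run c2 Q t' s') t s -> run (Seq c1 c2) Q t s.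
Proof.
move=> [t1 [s1 [ex1 ok1 /(_ ok1) [t2 [s2 [ex2 ok2 Q2]]]]]].
exists (t1 + t2), s2; split; rewrite ?addnA //; exact: ExecSeq ex2.
Qed.

Lemma run_if a c1 c2 Q t s : ok s -> small_expr a ->
  (ev s a != 0 -> run c1 Q (t + (cost a).+1) s) ->
  (ev s a = 0 -> run c2 Q (t + (cost a).+1) s) ->
  run (If a c1 c2) Q t s.
Proof.
move=> oks sm h1 h2; have evE := eval_ev oks sm.
case: (eqVneq (ev s a) 0) => [a0|a0].
  have [t' [s' [ex ok' Qs]]] := h2 a0; exists ((cost a).+1 + t'), s'.
  by split; rewrite ?addnA //; apply: ExecIf evE _; rewrite a0.
have [t' [s' [ex ok' Qs]]] := h1 a0; exists ((cost a).+1 + t'), s'.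
by split; rewrite ?addnA //; apply: ExecIf evE _; rewrite a0.
Qed.

Lemma ok_set_reg s r k :
  ok s -> r != 0 -> r != 2 -> k <= maxval -> ok (set_reg s r k).
Proof.
move=> [r0 r2 rB mB] n0 n2 kB; split=> //= [||r']; rewrite /=.
- by rewrite eq_sym (negbTE n0).
- by rewrite eq_sym (negbTE n2).
- by case: eqP.
Qed.

Lemma ok_set_mem s i k : ok s -> k <= maxval -> ok (set_mem s i k).
Proof. by move=> [r0 r2 rB mB] kB; split=> //= j; case: eqP. Qed.

Lemma run_straight c Q t s : ok s -> straight c -> wp c Q t s -> run c Q t s.
Proof.
elim: c Q t s => [|r a|a b|c1 IH1 c2 IH2|a c1 IH1 c2 IH2|] //= Q t s oks.
- by exists 1, s; split=> //; exact: ExecSkip.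
- case/and3P=> r0 r2 sm [kB Qs]; exists (cost a).+1, (set_reg s r (ev s a)).
  by split=> //; [exact/ExecSetReg/eval_ev | exact: ok_set_reg].
- case/andP=> sma smb [kB Qs].
  exists (cost a + cost b).+1, (set_mem s (ev s a) (ev s b)).
  by split=> //; [apply: ExecSetMem; exact: eval_ev | exact: ok_set_mem].
- case/andP=> st1 st2 /(IH1 _ _ _ oks st1) r1; apply: run_seq.
  by apply: run_weaken r1 => t' s' ok' w ok''; exact: IH2.
- case/and3P=> sm st1 st2 [w1 w2]; apply: run_if => // a0.
    by apply: IH1 => //; exact: w1.
  by apply: IH2 => //; exact: w2.
Qed.

(** The index [k] decreases with each iteration, which gives termination. As the invariant may also
    relate [k] to the clock, it can serve as a time potential. *)
Lemma run_while (I : nat -> nat -> state -> Prop) a c Q k t s :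
  small_expr a -> ok s -> I k t s ->
  (forall k t s, ok s -> I k t s -> ev s a != 0 ->
     run c (fun t' s' => exists2 k', k' < k & I k' t' s') (t + (cost a).+1) s) ->
  (forall k t s, ok s -> I k t s -> ev s a = 0 -> Q (t + (cost a).+1) s) ->
  run (While a c) Q t s.
Proof.
move=> sm oks Is body stop.
elim: k {-2}k (leqnn k) t s oks Is => [|K IH] k kK t s oks Is;
  (have evE := eval_ev oks sm; have [a0|a0] := eqVneq (ev s a) 0;
  [by exists (cost a).+1, s; split=> //;
    [apply: ExecWhileFalse; rewrite evE a0 | exact: stop Is a0] |]);
  have [t1 [s1 [ex1 ok1 [k1 lt1 I1]]]] := body _ _ _ oks Is a0.
  by move: (leq_trans lt1 kK); rewrite ltn0.
have [t2 [s2 [ex2 ok2 Q2]]] := IH k1 (leq_trans lt1 kK) _ _ ok1 I1.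
exists ((cost a).+1 + t1 + t2), s2; split=> //; first exact: ExecWhileTrue a0 ex1 ex2.
by rewrite !addnA.
Qed.

(** The clock is charged 2 for the initialisation, [cost b + 3] for a test and 4 for an increment.
    The bound [b] is evaluated anew at each test, so the body has to preserve its value [N]. *)
Lemma run_for (I : nat -> nat -> state -> Prop) (r : nat) b c N Q t s :
  ok s -> r != 0 -> r != 2 -> small_expr (Op Lt (Reg r) b) -> N <= n ->
  ev (set_reg s r 0) b = N -> I 0 (t + 2) (set_reg s r 0) ->
  (forall k t s, ok s -> k < N -> reg s r = k -> ev s b = N -> I k t s ->
     run c (fun t' s' => [/\ reg s' r = k, ev (set_reg s' r k.+1) b = N
       & I k.+1 (t' + 4) (set_reg s' r k.+1)]) (t + (cost b + 3)) s) ->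
  (forall t s, ok s -> I N t s -> Q (t + (cost b + 3)) s) ->
  run (For r b c) Q t s.
Proof.
move=> oks r0 r2 sm leN b0 I0 body stop.
apply: run_seq; apply: run_straight => //=; first by rewrite r0 r2.
split=> // _.
have evr s' : ev s' (Reg r) = reg s' r by case: r r0 r2 {I0 b0 sm body} => [|[|[|r]]].
have ltE s' : ev s' (Op Lt (Reg r) b) = (reg s' r < ev s' b) by rewrite -evr.
(* The variant of [run_while] counts down while the loop counts up, hence [N - k]. *)
pose J k t s := [/\ k <= N, reg s r = N - k, ev s b = N & I (N - k) t s].
have Bn : n <= maxval by rewrite /maxval; lia.
apply: (@run_while J _ _ _ N) => //.
- apply: ok_set_reg => //.
- by split; rewrite ?subnn ?b0 //= eqxx.
- move=> k t' s' ok' [kN rE bE Ik]; rewrite ltE rE bE => lt.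
  have {}lt : N - k < N by case: ltnP lt.
  apply: run_seq.
  have := body (N - k) _ _ ok' lt rE bE Ik; rewrite addn3 => /run_weaken; apply.
  move=> t1 s1 ok1 [r1 b1 I1] _; apply: run_straight => //=; first by rewrite r0 r2.
  rewrite -/(ev s1 (Reg r)) evr r1 addn1; split; first by lia.
  exists k.-1; first by lia.
  have e1 : (N - k).+1 = N - k.-1 by lia.
  by split; rewrite -?e1 //=; [lia | rewrite eqxx].
- move=> k t' s' ok' [kN rE bE Ik]; rewrite ltE rE bE => ge.
  have k0 : k = 0 by move: ge; case: ltnP => //; lia.
  rewrite (_ : (cost _).+1 = cost b + 3) /=; last by lia.
  by apply: stop => //; rewrite k0 subn0 in Ik.
Qed.

End ProgramLogic.

(** * Breadth-first search and the order matrix *)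

(* Register 2 holds [n * n].  Behind the adjacency matrix, eight arrays are
   interleaved: cell [i] of array [k] has address [n * n + 8 * i + k].
     0: one plus the distance from [x], zero if not yet discovered
     1: the order matrix, nonzero at [w * n + z] if [z] is below [w]
     2: the vertices below [w], from cell [w * n] on
     3: the number of vertices below [w]
     4, 5: the matching, mapping [w] to one plus a vertex below it, and inversely;
        zero means unmatched
     6: in a search, one plus the vertex from which [v] was reached as a lower
        vertex, zero if not reached
     7: the queue of the upper vertices reached, delimited by registers 7 and 8 *)
Definition addr (k : nat) (a : expr) : expr :=
  Op Add (Reg 2) (Op Add (Op Mul (Lit 8) a) (Lit k)).

Definition Cell k a := Read (addr k a).

Definition idx (a b : expr) : expr := Op Add (Op Mul a (Reg 0)) b.

(** Registers 3, 4 and 5 hold a distance, a vertex at that distance and a candidate for the next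
    level. Array 0 stores distances plus one, so the next level is marked by register 3 plus 2. *)
Definition relax : cmd :=
  If (Read (idx (Reg 4) (Reg 5)))
    (Seq
      (If (Cell 0 (Reg 5)) Skip
        (SetMem (addr 0 (Reg 5)) (Op Add (Reg 3) (Lit 2))))
      (If (Op Eq (Cell 0 (Reg 5)) (Op Add (Reg 3) (Lit 2)))
        (Seq (SetMem (addr 1 (idx (Reg 5) (Reg 4))) (Lit 1))
          (For 6 (Reg 0)
            (If (Cell 1 (idx (Reg 4) (Reg 6)))
              (SetMem (addr 1 (idx (Reg 5) (Reg 6))) (Lit 1)) Skip)))
        Skip))
    Skip.

(** Instead of keeping a queue, each round scans all vertices for those at the current distance.
    This costs O(n^2), and still each adjacency row is processed only once. *)
Definition compute_order : cmd :=
  For 3 (Reg 0) (For 4 (Reg 0)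
    (If (Op Eq (Cell 0 (Reg 4)) (Op Add (Reg 3) (Lit 1)))
      (For 5 (Reg 0) relax) Skip)).

(** * Disjointness of memory cells *)

Section Arrays.
Variable n : nat.

(** The array number is the offset modulo 8. Interleaving thus keeps the arrays disjoint without any
    bound on the indices. *)
Lemma cell_eq k k' i i' : k < 8 -> k' < 8 ->
  (n * n + (8 * i + k) == n * n + (8 * i' + k')) = (k == k') && (i == i').
Proof. move=> k8 k8'; apply/eqP/andP => [|[/eqP -> /eqP -> //]]; split; lia. Qed.

Lemma idx_lt u v : u < n -> v < n -> u * n + v < n * n.
Proof.
move=> un vn; apply: leq_trans (_ : u.+1 * n <= _); first by lia.
by rewrite leq_mul2r un orbT.
Qed.

Lemma idx_eq u v u' v' : v < n -> v' < n ->
  (u * n + v == u' * n + v') = (u == u') && (v == v').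
Proof.
move=> vn vn'; apply/eqP/andP => [E|[/eqP -> /eqP -> //]].
have n0 : 0 < n by lia.
have := congr1 (divn^~ n) E; have := congr1 (modn^~ n) E.
by rewrite !modnMDl !divnMDl // !modn_small // !divn_small // !addn0 => -> ->.
Qed.

Lemma adj_cell_eq u v k i : u < n -> v < n ->
  (u * n + v == n * n + (8 * i + k)) = false.
Proof. by move=> un vn; have := idx_lt un vn; lia. Qed.
End Arrays.

Section ComputeOrder.
Variables n W : nat.
Local Notation cell M k i := (M (n * n + (8 * i + k))).
Hypothesis n_gt0 : 0 < n.
Hypothesis W_large : forall c d, c <= 1000 -> d <= 1000 -> c * n ^ d <= W.
Variables (adj : rel nat) (D : nat -> nat) (x : nat) (below : rel nat).

(** The counterpart of [down_edge] on plain numbers, which is what the machine handles; the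
    hypotheses that follow are the only facts about the graph used in this section. *)
Definition dag u v := adj u v && (D v == (D u).+1).

Hypothesis x_lt : x < n.
Hypothesis D_root : D x = 0.
Hypothesis D_lt : forall v, v < n -> D v < n.
Hypothesis D_edge : forall u v, u < n -> v < n -> adj u v -> D v <= (D u).+1.
Hypothesis D_parent : forall v, v < n -> v != x -> exists2 u, u < n & dag u v.
Hypothesis belowE : forall z w, z < n -> w < n ->
  below z w <-> exists u, [/\ u < n, dag u w & z = u \/ below z u].

Definition adjacency (M : nat -> nat) :=
  forall u v, u < n -> v < n -> M (u * n + v) = adj u v.

Definition discovered (P : nat -> nat -> Prop) w :=
  w = x \/ exists u, [/\ u < n, P u w & dag u w].

Definition reached (P : nat -> nat -> Prop) w z :=
  exists u, [/\ u < n, P u w, dag u w & z = u \/ below z u].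

(** [V] and [E] are separate parameters because they get out of step inside [relax]: there [w] is
    already discovered while its row is still being copied. *)
Record order_inv (V : nat -> Prop) (E : nat -> nat -> Prop) (M : nat -> nat)
    : Prop := OrderInv {
  oi_adj : adjacency M;
  oi_level : forall w, w < n -> V w -> cell M 0 w = (D w).+1;
  oi_level0 : forall w, w < n -> ~ V w -> cell M 0 w = 0;
  oi_below : forall w z, w < n -> z < n -> (cell M 1 (w * n + z) != 0 <-> E w z);
  oi_zero : forall k i, 1 < k < 8 -> cell M k i = 0 }.

Lemma order_inv_ext V V' E E' M :
  (forall w, w < n -> V w <-> V' w) ->
  (forall w z, w < n -> z < n -> E w z <-> E' w z) ->
  order_inv V E M -> order_inv V' E' M.
Proof.
move=> VV' EE' [h1 h2 h3 h4 h5].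
split=> // [w wn /(VV' w wn)|w wn nd|w z wn zn]; first exact: h2.
  by apply: h3 => // /(VV' w wn).
by rewrite h4 //; exact: EE'.
Qed.

Definition pairs_inv (P : nat -> nat -> Prop) :=
  order_inv (discovered P) (reached P).

Lemma pairs_inv_ext (P P' : nat -> nat -> Prop) M :
  (forall u w, u < n -> w < n -> dag u w -> (P u w <-> P' u w)) ->
  pairs_inv P M -> pairs_inv P' M.
Proof.
move=> PP'; apply: order_inv_ext => [w wn|w z wn zn].
  split=> -[->|[u [un Pu uw]]]; (try by left);
  by right; exists u; split=> //; apply/(PP' u w).
by split=> -[u [un Pu uw zu]]; exists u; split=> //; apply/(PP' u w).
Qed.

(* [P u w] says that the pair [(u, w)] has been processed by [relax]. *)
Definition add_pair (P : nat -> nat -> Prop) v w : nat -> nat -> Prop :=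
  fun u y => P u y \/ u = v /\ y = w.

(** All pairs from earlier levels are processed, so row [v] is complete and may be copied. Only a
    down edge costs linear time, and the number of these is what bounds the total. *)
Lemma run_relax P v w t s :
  ok n s -> v < n -> w < n ->
  reg s 3 = D v -> reg s 4 = v -> reg s 5 = w ->
  (forall u y, u < n -> y < n -> dag u y -> D u < D v -> P u y) ->
  pairs_inv P (memory s) ->
  run n W relax (fun t' s' => [/\ reg s' 3 = D v, reg s' 4 = v, reg s' 5 = w,
    pairs_inv (add_pair P v w) (memory s') &
    t' <= t + 60 + dag v w * (60 * n + 60)]) t s.
Proof.
move=> oks vn wn r3 r4 r5 done inv.
have [ha hl h0 hb hz] := inv.
have Dvn := D_lt vn.
apply: run_if => //=; rewrite r4 r5 ha //; case avw: (adj v w) => //= _; last first.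
  apply: run_straight => //=; split=> //; last by lia.
  apply: pairs_inv_ext inv => u y un yn uy; split=> [|[//|[eu ey]]]; first by left.
  by move: uy; rewrite eu ey /dag avw.
have disc_le y : y < n -> D y <= D v -> discovered P y.
  move=> yn yv; have [->|yx] := eqVneq y x; first by left.
  have [u un uy] := D_parent yn yx; right; exists u; split=> //.
  by apply: done => //; case/andP: uy => _ /eqP uy; rewrite -uy.
have [vw|nvw] := boolP (dag v w); last first.
  have wv : D w <= D v.
    have := D_edge vn wn avw; rewrite leq_eqVlt => /orP [wv|]; last by rewrite ltnS.
    by rewrite /dag avw wv in nvw.
  have lw := hl w wn (disc_le w wn wv).
  apply: run_seq; apply: run_straight => //=; rewrite r5 lw; split=> // _ _.
  apply: run_if => //=; rewrite r5 r3 lw.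
    by move/eqP; case: eqP => //; lia.
  move=> _; apply: run_straight => //=.
  split=> //; last by lia.
  apply: pairs_inv_ext inv => u y un yn uy; split=> [|[//|[eu ey]]]; first by left.
  by rewrite eu ey in uy; rewrite uy in nvw.
have Dw : D w = (D v).+1 by case/andP: vw => _ /eqP.
pose P' := add_pair P v w.
have P'w : discovered P' w by right; exists v; split=> //; right.
have P'y y : y != w -> discovered P' y <-> discovered P y.
  move=> yw; split=> -[->|[u [un Pu uy]]]; (try by left); right; exists u; split=> //.
    by case: Pu => // -[_ yw']; rewrite yw' eqxx in yw.
  by left.
pose Q1 t' s' := [/\ reg s' 3 = D v, reg s' 4 = v, reg s' 5 = w,
  order_inv (discovered P') (reached P) (memory s') & t' <= t + 50].
apply: run_seq; apply: (run_weaken (Q := Q1)); last first.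
  apply: run_straight => //=; rewrite r3 r5; split=> [l0|l0].
    split=> //; last by lia.
    apply: order_inv_ext inv => // y yn; have [->|yw] := eqVneq y w; last first.
      by apply: iff_sym; exact: P'y.
    split=> // _; apply: contrapT => nd; move: l0; by rewrite h0.
  split; first by rewrite /maxval; lia.
  split=> //; last by lia.
  split=> [u y un yn|y yn dy|y yn dy|y z yn zn|k i /andP [k1 k8]] /=.
  - by rewrite adj_cell_eq // ha.
  - rewrite cell_eq //=; case: eqVneq => [->|yw]; first by lia.
    by apply: hl => //; apply/P'y.
  - rewrite cell_eq //=; case: eqVneq => [yw|yw]; first by rewrite yw in dy.
    by apply: h0 => // dP; apply: dy; apply/P'y.
  - by rewrite cell_eq //=; exact: hb.
  - by rewrite cell_eq // (_ : k == 0 = false); [apply: hz; rewrite k1|by lia].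
move=> t1 s1 ok1 [r13 r14 r15 [ha1 hl1 h01 hb1 hz1] t1t] _.
apply: run_if => //=; rewrite r13 r15 hl1 // Dw; last by move/eqP; case: eqP => //; lia.
move=> _; apply: run_seq; apply: run_straight => //=; rewrite r14 r15; split.
  by rewrite /maxval; lia.
move=> ok2.
pose I k t' s' := [/\ reg s' 3 = D v, reg s' 4 = v, reg s' 5 = w,
  order_inv (discovered P')
    (fun y z => reached P y z \/ y = w /\ (z = v \/ below z v /\ z < k)) (memory s')
  & t' <= t + 100 + 60 * k].
apply: (run_for n_gt0 W_large (I := I) (N := n)) => //=.
- split=> //; last by lia.
  split=> [u y un yn|y yn dy|y yn dy|y z yn zn|k i /andP [k1 k8]] /=.
  + by rewrite adj_cell_eq // ha1.
  + by rewrite cell_eq //=; exact: hl1.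
  + by rewrite cell_eq //=; exact: h01.
  + rewrite cell_eq //= idx_eq //; have {}hb1 := hb1 y z yn zn.
    case: (eqVneq y w) => [yw|yw] /=; first case: (eqVneq z v) => [zv|zv] /=.
    * by split=> // _; right; split=> //; left.
    * by rewrite hb1; split=> [h|[h|[_ [zv'|[]]]]] //; [left|rewrite zv' eqxx in zv].
    * by rewrite hb1; split=> [h|[h|[yw']]] //; [left|rewrite yw' eqxx in yw].
  + by rewrite cell_eq // (_ : k == 1 = false); [apply: hz1; rewrite k1|by lia].
- move=> k t2 s2 ok2' kn r26 _ [r23 r24 r25 [ha2 hl2 h02 hb2 hz2] t2t].
  (* The row being written is not the row being read. *)
  have vw' : v != w by apply/eqP => vw'; move: Dw; rewrite vw'; lia.
  have rv : reached P v k <-> below k v.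
    rewrite belowE //; split=> -[u [un]]; first by exists u.
    move=> uv ku; exists u; split=> //; apply: done => //.
    by case/andP: uv => _ /eqP ->.
  have kv : cell (memory s2) 1 (v * n + k) != 0 <-> below k v.
    rewrite hb2 //; split=> [[/rv //|[vw'']]|/rv]; last by left.
    by rewrite vw'' eqxx in vw'.
  apply: run_straight => //=; rewrite r24 r25 r26; split=> [/kv bk|bk].
    split; first by rewrite /maxval; lia.
    split=> //; split=> //; last by lia.
    split=> [u y un yn|y yn dy|y yn dy|y z yn zn|k' i /andP [k1 k8]] /=.
    + by rewrite adj_cell_eq // ha2.
    + by rewrite cell_eq //=; exact: hl2.
    + by rewrite cell_eq //=; exact: h02.
    + rewrite cell_eq //= idx_eq //.
      case: (eqVneq y w) => [yw|yw] /=; first case: (eqVneq z k) => [zk|zk] /=.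
      * by split=> // _; right; split=> //; right; rewrite zk.
      * rewrite hb2 // ltnS [z <= k]leq_eqVlt (negbTE zk) /=; tauto.
      * rewrite hb2 //; split=> -[h|[yw']]; by [left|rewrite yw' eqxx in yw].
    + by rewrite cell_eq // (_ : k' == 1 = false); [apply: hz2; rewrite k1|by lia].
  split=> //; split=> //; last by lia.
  split=> // y z yn zn; rewrite hb2 // ltnS [z <= k]leq_eqVlt.
  have nk : ~ below k v by move/kv; rewrite bk.
  split.
    case=> [|[-> [->|[zv zk]]]]; [by left|by right; split=> //; left|].
    by right; split=> //; right; rewrite zk orbT.
  case=> [|[-> [->|[zv /orP [/eqP zk|zk]]]]]; [by left|by right; split=> //; left| |].
    by rewrite zk in zv.
  by right; split=> //; right.
- move=> t2 s2 ok2' [r23 r24 r25 inv2 t2t]; split=> //; last by rewrite mul1n; lia.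
  apply: order_inv_ext inv2 => // y z yn zn; split.
    case=> [[u [un Pu uy zu]]|[-> zv]]; first by exists u; split=> //; left.
    by exists v; split=> //; [right | case: zv => [|[]]; auto].
  case=> u [un [Pu|[-> ->]] uy zu]; first by left; exists u.
  by right; split=> //; case: zu; auto.
Qed.

Definition children v := \sum_(0 <= w < n) dag v w.

Definition row_time v := 70 * n + 20 + (60 * n + 60) * children v.

Lemma run_row P v t s :
  ok n s -> v < n -> reg s 3 = D v -> reg s 4 = v ->
  (forall u y, u < n -> y < n -> dag u y -> D u < D v -> P u y) ->
  pairs_inv P (memory s) ->
  run n W (For 5 (Reg 0) relax) (fun t' s' => [/\ reg s' 3 = D v, reg s' 4 = v,
    pairs_inv (fun u y => P u y \/ u = v) (memory s') & t' <= t + row_time v]) t s.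
Proof.
move=> oks vn r3 r4 done inv.
pose I k t' s' := [/\ reg s' 3 = D v, reg s' 4 = v,
  pairs_inv (fun u y => P u y \/ u = v /\ y < k) (memory s')
  & t' <= t + 2 + 70 * k + (60 * n + 60) * \sum_(0 <= w < k) dag v w].
apply: (run_for n_gt0 W_large (I := I) (N := n)) => //=.
- split=> //; last by lia.
  by apply: pairs_inv_ext inv => u y un yn uy; split=> [|[|[]]] //; left.
- move=> k t1 s1 ok1 kn r15 _ [r13 r14 inv1 t1t].
  apply: (run_weaken _ (run_relax _ ok1 vn kn r13 r14 r15 _ inv1)).
    move=> t2 s2 ok2 [r23 r24 r25 inv2 t2t]; split=> //.
    split=> //; last by rewrite big_nat_recr //= mulnDr; lia.
    apply: pairs_inv_ext inv2 => u y un yn uy; rewrite /add_pair ltnS [y <= k]leq_eqVlt.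
    split=> [[[|[-> ->]]|[-> ->]]|[|[-> /orP [/eqP ->|yk]]]]; rewrite ?eqxx ?orbT; by intuition.
  by move=> u y un yn uy uv; left; exact: done.
- move=> t1 s1 ok1 [r13 r14 inv1 t1t]; split=> //; last by rewrite /row_time /children; lia.
  apply: pairs_inv_ext inv1 => u y un yn uy; rewrite yn; intuition.
Qed.

Definition order_time := 150 * n * n + 200 * n * \sum_(0 <= v < n) children v + 100 * n + 10.

Lemma run_compute_order t s :
  ok n s -> adjacency (memory s) ->
  (forall k i, k < 8 -> cell (memory s) k i = ((k == 0) && (i == x))) ->
  run n W compute_order (fun t' s' => [/\
    forall w z, w < n -> z < n -> (cell (memory s') 1 (w * n + z) != 0) = below z w,
    forall k i, 1 < k < 8 -> cell (memory s') k i = 0 &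
    t' <= t + order_time]) t s.
Proof.
move=> oks adjs cells.
(* The condition [D u < 0] is empty: no pair has been processed and only [x] is discovered. *)
have inv0 : pairs_inv (fun u _ => D u < 0) (memory s).
  split=> // [w wn|w wn nd|w z wn zn|k i /andP [k1 k8]]; rewrite cells //=.
  - by case=> [->|[u []]] //; rewrite eqxx D_root.
  - by case: eqP => // wx; case: nd; left.
  - by split=> // -[u []].
  - by case: k k1 {k8}.
pose f d v := 30 + (D v == d) * row_time v.
pose I d t' s' := pairs_inv (fun u _ => D u < d) (memory s') /\
  t' <= t + 2 + \sum_(0 <= i < d) (20 + \sum_(0 <= v < n) f i v).
apply: (run_for n_gt0 W_large (I := I) (N := n)) => //=.
- by split=> //; lia.
- move=> d t1 s1 ok1 dn r13 _ [inv1 t1t].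
  pose J k t' s' := [/\ reg s' 3 = d,
    pairs_inv (fun u _ => D u < d \/ D u = d /\ u < k) (memory s')
    & t' <= t1 + 10 + \sum_(0 <= v < k) f d v].
  apply: (run_for n_gt0 W_large (I := J) (N := n)) => //=.
  + split=> //; last by lia.
    by apply: pairs_inv_ext inv1 => u y un yn uy; split=> [|[|[]]] //; left.
  + move=> v t2 s2 ok2 vn r24 _ [r23 inv2 t2t].
    have [ha2 hl2 h02 hb2 hz2] := inv2.
    (* Vertices at distance [d] are already discovered through a parent, and an undiscovered vertex
       holds 0, which never equals [d + 1]. *)
    have lev : (cell (memory s2) 0 v == d + 1) = (D v == d).
      have [Dv|Dv] := eqVneq (D v) d.
        rewrite hl2 // ?Dv ?addn1 ?eqxx //.
        have [->|vx] := eqVneq v x; first by left.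
        have [u un uv] := D_parent vn vx; right; exists u; split=> //.
        by left; case/andP: uv => _ /eqP uv; rewrite -Dv uv.
      case: (pselect (discovered (fun u _ => D u < d \/ D u = d /\ u < v) v)) => h.
        by rewrite hl2 // addn1 eqSS (negbTE Dv).
      by rewrite h02 // addn1.
    apply: run_if => //=; rewrite r23 r24 lev.
      case: (D v =P d) => // Dv _.
      have r23' : reg s2 3 = D v by rewrite Dv.
      apply: (run_weaken _ (run_row _ ok2 vn r23' r24 _ inv2)).
        move=> t3 s3 ok3 [r33 r34 inv3 t3t]; split=> //.
        split=> //; first by rewrite -Dv.
          apply: pairs_inv_ext inv3 => u y un yn uy; rewrite ltnS [u <= v]leq_eqVlt.
          split=> [[[|[-> ->]]|->]|[|[-> /orP [/eqP ->|yk]]]]; rewrite ?eqxx ?orbT; by intuition.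
        rewrite big_nat_recr //=.
        have -> : f d v = 30 + row_time v by rewrite /f Dv eqxx mul1n.
        lia.
      by move=> u y un yn uy uv; left; rewrite -Dv.
    case: (D v =P d) => // Dv _; apply: run_straight => //=; split=> //; split=> //.
      apply: pairs_inv_ext inv2 => u y un yn uy; rewrite ltnS [u <= v]leq_eqVlt.
      split=> [[|[-> ->]]|[|[Du /orP [/eqP uv|uv]]]]; rewrite ?orbT; try by intuition.
      by case: Dv; rewrite -uv.
    by rewrite big_nat_recr //=; have : 30 <= f d v := leq_addr _ _; lia.
  + move=> t2 s2 ok2 [r23 inv2 t2t]; split=> //; split.
      apply: pairs_inv_ext inv2 => u y un yn uy; rewrite ltnS [D u <= d]leq_eqVlt un.
      by split=> [[->|[->]]|/orP [/eqP|]]; rewrite ?eqxx ?orbT; intuition.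
    by rewrite big_nat_recr //=; lia.
- move=> t1 s1 ok1 [[ha1 hl1 h01 hb1 hz1] t1t]; split=> //.
  + move=> w z wn zn; apply/idP/idP => [/hb1|] .
      move=> /(_ wn zn) [u [un _ uw zu]]; apply/belowE => //; by exists u.
    move/belowE => /(_ zn wn) [u [un uw zu]]; apply/hb1 => //.
    by exists u; split=> //; exact: D_lt.
  + have : \sum_(0 <= i < n) (20 + \sum_(0 <= v < n) f i v)
      = 20 * n + 30 * (n * n) + \sum_(0 <= v < n) row_time v.
      rewrite big_split /= sum_nat_const_nat subn0 [n * 20]mulnC -addnA; congr (_ + _).
      (* After the exchange of sums, [row_time v] is charged once, in round [D v], which takes place
         because [D v < n]. *)
      rewrite exchange_big_nat /=.
      rewrite (eq_big_nat _ _ (F2 := fun v => 30 * n + row_time v)); last first.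
        move=> v /andP [_ vn]; rewrite big_split /= sum_nat_const_nat subn0 mulnC; congr (_ + _).
        rewrite big_mkord (bigD1 (Ordinal (D_lt vn))) //= eqxx mul1n big1 ?addn0 // => i.
        move=> iD; rewrite (_ : _ == _ = false) //.
        by apply: contraNF iD => /eqP Dv; apply/eqP/val_inj.
      by rewrite big_split /= sum_nat_const_nat subn0; lia.
    have : \sum_(0 <= v < n) row_time v =
        (70 * n + 20) * n + (60 * n + 60) * \sum_(0 <= v < n) children v.
      by rewrite big_split /= sum_nat_const_nat subn0 -big_distrr /=; lia.
    rewrite /order_time => -> e1; rewrite e1 in t1t.
    apply: leq_trans (_ : _ <= _); first exact: leq_add t1t (leqnn _).
    have := leq_mul n_gt0 (leqnn (\sum_(0 <= v < n) children v)); lia.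
Qed.

End ComputeOrder.

(** * Lists of lower vertices *)

(** With lists, scanning a vertex costs its number of lower vertices instead of [n]. Array 3 doubles
    as the write position while a list grows. *)
Definition compute_lists : cmd :=
  For 5 (Reg 0) (For 6 (Reg 0)
    (If (Cell 1 (idx (Reg 5) (Reg 6)))
      (Seq (SetMem (addr 2 (idx (Reg 5) (Cell 3 (Reg 5)))) (Reg 6))
        (SetMem (addr 3 (Reg 5)) (Op Add (Cell 3 (Reg 5)) (Lit 1))))
      Skip)).

Section ComputeLists.
Variables n W : nat.
Local Notation cell M k i := (M (n * n + (8 * i + k))).
Hypothesis n_gt0 : 0 < n.
Hypothesis W_large : forall c d, c <= 1000 -> d <= 1000 -> c * n ^ d <= W.
Variable below : rel nat.

Definition lower w := [seq z <- iota 0 n | below z w].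

Definition lists (L : nat -> seq nat) (M : nat -> nat) :=
  forall w, w < n -> cell M 3 w = size (L w) /\
    forall j, j < size (L w) -> cell M 2 (w * n + j) = nth 0 (L w) j.

Record lists_inv (L : nat -> seq nat) (M : nat -> nat) : Prop := ListsInv {
  li_below : forall w z, w < n -> z < n -> (cell M 1 (w * n + z) != 0) = below z w;
  li_zero : forall k i, 3 < k < 8 -> cell M k i = 0;
  li_lists : lists L M }.

Lemma lists_inv_ext L L' M :
  (forall w, w < n -> L w = L' w) -> lists_inv L M -> lists_inv L' M.
Proof.
by move=> LL' [h1 h2 h3]; split=> // w wn; rewrite -LL' //; exact: h3.
Qed.

Definition lists_time := 60 * n * n + 20 * n + 10.

Lemma run_compute_lists t s : ok n s ->
  (forall w z, w < n -> z < n -> (cell (memory s) 1 (w * n + z) != 0) = below z w) ->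
  (forall k i, 1 < k < 8 -> cell (memory s) k i = 0) ->
  run n W compute_lists (fun t' s' => [/\ lists lower (memory s'),
    forall k i, 3 < k < 8 -> cell (memory s') k i = 0 & t' <= t + lists_time]) t s.
Proof.
move=> oks belows zeros.
pose I w t' s' :=
  lists_inv (fun y => if y < w then lower y else [::]) (memory s') /\
  t' <= t + 2 + w * (60 * n + 20).
apply: (run_for n_gt0 W_large (I := I) (N := n)) => //=.
- split; last by lia.
  by split=> // [k i /andP [k3 k8]|w wn]; rewrite zeros //; lia.
- move=> w t1 s1 ok1 wn r15 _ [inv1 t1t].
  pose J z t' s' := [/\ reg s' 5 = w,
    lists_inv (fun y => if y < w then lower y else
      if y == w then [seq v <- iota 0 z | below v w] else [::]) (memory s')
    & t' <= t1 + 6 + z * 60].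
  apply: (run_for n_gt0 W_large (I := J) (N := n)) => //=.
  + split=> //; last by lia.
    by apply: lists_inv_ext inv1 => y yn; case: (y < w); case: (y == w).
  + move=> z t2 s2 ok2 zn r26 _ [r25 inv2 t2t].
    have [hb hz hl] := inv2; have [] := hl w wn; rewrite ltnn eqxx.
    set l := [seq v <- iota 0 z | below v w] => deg _.
    have sl : size l <= z by rewrite size_filter -{2}(size_iota 0 z) count_size.
    have lS : [seq v <- iota 0 z.+1 | below v w] = if below z w then rcons l z else l.
      by rewrite -addn1 iotaD filter_cat /=; case: ifP; rewrite ?cats1 ?cats0.
    apply: run_straight => //=; rewrite r25 r26 hb //.
    rewrite !cell_eq //= deg; split=> bzw; last first.
      have bF : below z w = false by rewrite -hb // bzw.
      split=> //; split=> //; last by lia.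
      apply: lists_inv_ext inv2 => y yn; case: ifP => // _; case: ifP => // _.
      by rewrite lS bF.
    have bT := bzw.
    split; first by rewrite /maxval; lia.
    split; first by rewrite /maxval; lia.
    split=> //; split=> //; last by lia.
    split=> [y v yn vn|k i /andP [k3 k8]|y yn] /=.
    * by rewrite !cell_eq //= hb.
    * rewrite !cell_eq // (_ : k == 3 = false); last by lia.
      by rewrite (_ : k == 2 = false) /=; [apply: hz; rewrite k3 | lia].
    * rewrite !cell_eq //=; have [deg' nth'] := hl y yn.
      case: (eqVneq y w) deg' nth' => [yw|yw] deg' nth'; last first.
        split=> //= j jl; rewrite !cell_eq //= idx_eq; last by lia.
          by rewrite (negbTE yw); exact: nth'.
        apply: leq_trans jl _; case: ifP => // _.
        by rewrite size_filter -{2}(size_iota 0 n) count_size.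
      move: deg' nth'; rewrite yw ltnn; move: (lS) => /= ->; rewrite bT -/l.
      move=> deg' nth'; split; first by rewrite size_rcons addn1.
      move=> j; rewrite size_rcons ltnS => jl.
      rewrite !cell_eq //= idx_eq ?eqxx /=; [|by lia..].
      rewrite nth_rcons; case: ltngtP jl => // jl _.
      exact: nth'.
  + move=> t2 s2 ok2 [r25 inv2 t2t]; split=> //; split; last by lia.
    apply: lists_inv_ext inv2 => y yn; rewrite ltnS [y <= w]leq_eqVlt.
    by case: eqVneq => [->|] //=; rewrite ltnn.
- move=> t1 s1 ok1 [[hb hz hl] t1t]; split=> //; last by rewrite /lists_time; lia.
  by move=> w wn; have := hl w wn; rewrite wn.
Qed.
End ComputeLists.

(** * Searching for augmenting paths *)

Definition incr r := SetReg r (Op Add (Reg r) (Lit 1)).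

Definition init_search : cmd :=
  Seq (SetReg 8 (Lit 0))
  (Seq (For 4 (Reg 0)
    (Seq (SetMem (addr 6 (Reg 4)) (Lit 0))
      (If (Cell 4 (Reg 4)) Skip
        (Seq (SetMem (addr 7 (Reg 8)) (Reg 4)) (incr 8)))))
  (Seq (SetReg 7 (Lit 0)) (SetReg 11 (Lit 0)))).

(** Finding an unmatched lower vertex does not stop the search: register 11 is merely overwritten,
    and the queue is always exhausted. *)
Definition scan : cmd :=
  For 10 (Cell 3 (Reg 9))
    (Seq (SetReg 4 (Cell 2 (idx (Reg 9) (Reg 10))))
      (If (Cell 6 (Reg 4)) Skip
        (Seq (SetMem (addr 6 (Reg 4)) (Op Add (Reg 9) (Lit 1)))
          (If (Cell 5 (Reg 4))
            (Seq (SetMem (addr 7 (Reg 8)) (Op Defs.Sub (Cell 5 (Reg 4)) (Lit 1)))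
              (incr 8))
            (SetReg 11 (Op Add (Reg 4) (Lit 1))))))).

Definition search : cmd :=
  While (Op Lt (Reg 7) (Reg 8))
    (Seq (SetReg 9 (Cell 7 (Reg 7))) (Seq (incr 7) scan)).

(** Register 11 passes from a lower vertex to the old mate of its predecessor. As 0 encodes
    unmatched, the loop ends by itself at the root of the augmenting path. *)
Definition flip : cmd :=
  While (Reg 11)
    (Seq (SetReg 4 (Op Defs.Sub (Reg 11) (Lit 1)))
    (Seq (SetReg 9 (Op Defs.Sub (Cell 6 (Reg 4)) (Lit 1)))
    (Seq (SetReg 11 (Cell 4 (Reg 9)))
    (Seq (SetMem (addr 4 (Reg 9)) (Op Add (Reg 4) (Lit 1)))
      (SetMem (addr 5 (Reg 4)) (Op Add (Reg 9) (Lit 1))))))).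

(** Register 12 remembers whether the search succeeded, since [flip] clears register 11. *)
Definition compute_matching : cmd :=
  Seq (SetReg 12 (Lit 1))
    (While (Reg 12)
      (Seq init_search (Seq search (Seq (SetReg 12 (Reg 11)) flip)))).

Section ComputeMatching.
Variables n W : nat.
Local Notation cell M k i := (M (n * n + (8 * i + k))).
Hypothesis n_gt0 : 0 < n.
Hypothesis W_large : forall c d, c <= 1000 -> d <= 1000 -> c * n ^ d <= W.
Variable L : nat -> seq nat.
Hypothesis L_lt : forall w v, v \in L w -> v < n.
Hypothesis L_size : forall w, size (L w) <= n.

Record matching_inv (M : nat -> nat) : Prop := MatchingInv {
  mi_lists : lists n L M;
  mi_mate : forall u v, u < n -> v < n -> cell M 4 u = v.+1 <-> cell M 5 v = u.+1;
  mi_le4 : forall u, u < n -> cell M 4 u <= n;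
  mi_le5 : forall v, v < n -> cell M 5 v <= n;
  mi_edge : forall u v, u < n -> cell M 4 u = v.+1 -> v \in L u }.

Lemma lists_frame (M M' : nat -> nat) :
  (forall i, cell M' 2 i = cell M 2 i) -> (forall i, cell M' 3 i = cell M 3 i) ->
  lists n L M -> lists n L M'.
Proof.
move=> e2 e3 l w wn; rewrite e3; have [-> h] := l w wn.
by split=> // j; rewrite e2; exact: h.
Qed.

Lemma matching_inv_frame (M M' : nat -> nat) :
  (forall k i, 1 < k < 6 -> cell M' k i = cell M k i) ->
  matching_inv M -> matching_inv M'.
Proof.
move=> E [h1 h2 h3 h4 h5]; split; first by apply: lists_frame h1 => i; exact: E.
- by move=> u v un vn; rewrite !E //; exact: h2.
- by move=> u un; rewrite E //; exact: h3.
- by move=> u un; rewrite E //; exact: h4.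
- by move=> u v un; rewrite E //; exact: h5.
Qed.

(* [q] is the queue, whose first [h] elements have been dequeued; [j] elements
   of the list of the last of these have been scanned; [f] is the register
   holding one plus the unmatched lower element found last. *)
Record search_inv (q : seq nat) (h j f : nat) (M : nat -> nat) : Prop := SearchInv {
  si_matching : matching_inv M;
  si_queue : forall i, i < size q -> cell M 7 i = nth 0 q i;
  si_uniq : uniq q;
  si_lt : forall u, u \in q -> u < n;
  si_head : h <= size q;
  si_mem : forall u, u < n -> (u \in q <->
    cell M 4 u = 0 \/ exists v, [/\ v < n, cell M 4 u = v.+1 & cell M 6 v != 0]);
  si_pred : forall v, v < n -> cell M 6 v != 0 ->
    exists u, [/\ u \in take h q, cell M 6 v = u.+1 & v \in L u];
  si_rank : forall u v, u \in q -> v < n -> cell M 4 u = v.+1 ->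
    exists u', cell M 6 v = u'.+1 /\ index u' q < index u q;
  si_scanned : forall i v, i < h ->
    v \in take (if i.+1 == h then j else n) (L (nth 0 q i)) -> cell M 6 v != 0;
  si_not_found : f = 0 -> forall v, v < n -> cell M 6 v != 0 -> cell M 5 v != 0;
  si_found : forall v, f = v.+1 -> [/\ v < n, cell M 6 v != 0 & cell M 5 v = 0] }.

Lemma size_queue (q : seq nat) : uniq q -> (forall u, u \in q -> u < n) -> size q <= n.
Proof.
move=> uq qn; rewrite -(size_iota 0 n); apply: uniq_leq_size => // u /qn.
by rewrite mem_iota.
Qed.

Section Visit.
Variables (q : seq nat) (h j f : nat) (M : nat -> nat).
Hypothesis inv : search_inv q h.+1 j f M.
Let u := nth 0 q h.
Let v := nth 0 (L u) j.
Hypothesis j_lt : j < size (L u).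

Let u_take : u \in take h.+1 q.
Proof. by rewrite (take_nth 0) ?mem_rcons ?inE ?eqxx //; exact: (si_head inv). Qed.

Let v_lt : v < n.
Proof. by apply: (@L_lt u); exact: mem_nth. Qed.

Let v_L : v \in L u.
Proof. exact: mem_nth. Qed.

(** The part shared by the three possible outcomes for the [j]-th list entry [v]: already reached,
    new and unmatched, new and matched. *)
Lemma scanned_step (q' : seq nat) (M' : nat -> nat) :
  (forall i, i < h.+1 -> nth 0 q' i = nth 0 q i) ->
  (forall y, cell M 6 y != 0 -> cell M' 6 y != 0) -> cell M' 6 v != 0 ->
  forall i y, i < h.+1 ->
    y \in take (if i.+1 == h.+1 then j.+1 else n) (L (nth 0 q' i)) ->
    cell M' 6 y != 0.
Proof.
move=> qq' MM' vM' i y ih; rewrite qq' //; case: eqP => [[ih']|ih'] yi.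
  move: yi; rewrite ih' -/u (take_nth 0) // -/v mem_rcons inE.
  case/orP=> [/eqP -> //|yj]; apply: MM'.
  by apply: (si_scanned inv ih); rewrite ih' eqxx.
by apply: MM'; apply: (si_scanned inv ih); case: eqP.
Qed.

Lemma visit_old : cell M 6 v != 0 -> search_inv q h.+1 j.+1 f M.
Proof.
by move=> Mv; case: (inv) => *; split=> //; exact: scanned_step.
Qed.

Hypothesis v_new : cell M 6 v = 0.

Lemma visit_unmatched (M' : nat -> nat) :
  (forall k i, 1 < k < 8 -> cell M' k i =
     if (k == 6) && (i == v) then u.+1 else cell M k i) ->
  cell M 5 v = 0 -> search_inv q h.+1 j.+1 v.+1 M'.
Proof.
move=> E M5; have E6 y : cell M 6 y != 0 -> cell M' 6 y != 0.
  by rewrite E //=; case: (y =P v).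
have E6v : cell M' 6 v = u.+1 by rewrite E //= eqxx.
have E6n y : y != v -> cell M' 6 y = cell M 6 y by move=> yv; rewrite E //= (negbTE yv).
have Ek k i : 1 < k < 8 -> k != 6 -> cell M' k i = cell M k i.
  by move=> k8 /negbTE k6; rewrite E // k6.
case: (inv) => i1 i2 i3 i4 i5 i6 i7 i8 i9 i10 i11; split=> //.
- by apply: matching_inv_frame i1 => k i k6; rewrite Ek //; lia.
- by move=> i iq; rewrite Ek // i2.
- move=> y yn; rewrite i6 // Ek //; split=> -[y4|[z [zn yz z6]]]; try by left.
    by right; exists z; split=> //; exact: E6.
  (* An unmatched [v] is nobody's mate, so marking it lets no further upper vertex count as
     reached. *)
  right; exists z; split=> //; rewrite -E6n //; apply/eqP => zv.
  by move/(mi_mate i1 yn zn): yz; rewrite zv M5.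
- move=> y yn; have [->|yv] := eqVneq y v; last by rewrite E6n //; exact: i7.
  by exists u.
- move=> y z yq zn; rewrite (Ek 4) // => yz; have [y' [zy' lt]] := i8 y z yq zn yz.
  exists y'; split=> //; rewrite E6n //; apply/eqP => zv.
  by move: zy'; rewrite zv v_new.
- by apply: scanned_step; rewrite ?E6v.
- by move=> y [<-]; rewrite (Ek 5) //; split=> //; rewrite E6v.
Qed.

Lemma visit_matched w (M' : nat -> nat) :
  (forall k i, 1 < k < 8 -> cell M' k i =
     if (k == 7) && (i == size q) then w
     else if (k == 6) && (i == v) then u.+1 else cell M k i) ->
  cell M 5 v = w.+1 -> search_inv (rcons q w) h.+1 j.+1 f M'.
Proof.
move=> E M5; have E6 y : cell M 6 y != 0 -> cell M' 6 y != 0.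
  by rewrite E //=; case: (y =P v).
have E6v : cell M' 6 v = u.+1 by rewrite E //= eqxx.
have E6n y : y != v -> cell M' 6 y = cell M 6 y by move=> yv; rewrite E //= (negbTE yv).
have Ek k i : 1 < k < 6 -> cell M' k i = cell M k i.
  by case: k => [|[|[|[|[|[|k]]]]]] // k6; rewrite E.
case: (inv) => i1 i2 i3 i4 i5 i6 i7 i8 i9 i10 i11.
have wn : w < n by rewrite -M5; exact: mi_le5.
have w4 : cell M 4 w = v.+1 by apply/(mi_mate i1).
(* [w] is matched, to [v], so it could have been queued only after [v] was marked. *)
have wq : w \notin q.
  apply/negP => /(i6 w wn) [|[z [zn]]]; rewrite w4 // => -[<-].
  by rewrite v_new.
have th : take h.+1 (rcons q w) = take h.+1 q.
  by rewrite -cats1 takel_cat.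
have idxq y : y \in q -> index y (rcons q w) = index y q.
  by move=> yq; rewrite -cats1 index_cat yq.
split=> //.
- by apply: matching_inv_frame i1 => k i k6; rewrite Ek.
- move=> i; rewrite size_rcons ltnS nth_rcons E //= => iq.
  case: ltngtP iq => // iq _; exact: i2.
- by rewrite rcons_uniq wq.
- by move=> y; rewrite mem_rcons inE => /orP [/eqP -> //|]; exact: i4.
- by rewrite size_rcons; exact: leqW.
- move=> y yn; rewrite mem_rcons inE Ek //; split.
    case/orP=> [/eqP ->|/(i6 y yn) [|[z [zn yz z6]]]]; [|by left|].
      by right; exists v; rewrite E6v.
    by right; exists z; split=> //; exact: E6.
  case=> [y4|[z [zn yz z6]]]; first by apply/orP; right; apply/i6 => //; left.
  have [zv|zv] := eqVneq z v.
    by move/(mi_mate i1 yn zn): yz; rewrite zv M5 => -[->]; rewrite eqxx.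
  apply/orP; right; apply/i6 => //; right; exists z; split=> //.
  by rewrite -E6n.
- move=> y yn; rewrite th.
  have [->|yv] := eqVneq y v; last by rewrite E6n //; exact: i7.
  by exists u.
- move=> y z; rewrite mem_rcons inE => /orP [/eqP ->|yq] zn; rewrite (Ek 4) //.
    rewrite w4 => -[<-]; exists u; split=> //.
    have uq := mem_take u_take.
    by rewrite idxq // -cats1 index_cat (negbTE wq) /= eqxx addn0 index_mem.
  move=> yz; have [y' [zy' lt]] := i8 y z yq zn yz; exists y'; split.
    by rewrite E6n //; apply/eqP => zv; move: zy'; rewrite zv v_new.
  by rewrite !idxq // -index_mem; apply: ltn_trans lt _; rewrite index_mem.
- apply: scanned_step; rewrite ?E6v // => i ih.
  by rewrite nth_rcons (leq_trans ih).
- move=> f0 y yn; have [->|yv] := eqVneq y v; first by rewrite (Ek 5) // M5.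
  by rewrite E6n // (Ek 5) //; exact: i10.
- move=> y /i11 [yn y6 y5]; rewrite (Ek 5) //; split=> //; exact: E6.
Qed.

End Visit.

End ComputeMatching.

(** * Correctness and cost of a single search *)

Section ComputeMatching.
Variables n W : nat.
Local Notation cell M k i := (M (n * n + (8 * i + k))).
Hypothesis n_gt0 : 0 < n.
Hypothesis W_large : forall c d, c <= 1000 -> d <= 1000 -> c * n ^ d <= W.
Variable L : nat -> seq nat.
Hypothesis L_lt : forall w v, v \in L w -> v < n.
Hypothesis L_size : forall w, size (L w) <= n.

Local Notation search_inv := (search_inv n L).
Local Notation matching_inv := (matching_inv n L).

Definition mates (M : nat -> nat) i := cell M 4 i.

Lemma search_inv_dequeue q h f M : h < size q ->
  search_inv q h n f M -> search_inv q h.+1 0 f M.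
Proof.
move=> hq; case=> i1 i2 i3 i4 i5 i6 i7 i8 i9 i10 i11; split=> //.
  move=> v vn v6; have [u [uq uv vL]] := i7 v vn v6; exists u; split=> //.
  by rewrite (take_nth 0) // mem_rcons inE uq orbT.
move=> i v; rewrite ltnS leq_eqVlt eqSS; case: eqP => [->|_] //=; first by rewrite take0.
move=> ih vL; apply: (i9 i v ih); by case: ifP.
Qed.

(** Between two scans the position [n] stands for a completed list, whatever its length, since lists
    have at most [n] entries. *)
Lemma search_inv_row q h f M :
  search_inv q h.+1 (size (L (nth 0 q h))) f M -> search_inv q h.+1 n f M.
Proof.
case=> i1 i2 i3 i4 i5 i6 i7 i8 i9 i10 i11; split=> //.
move=> i v ih; rewrite if_same => vL; apply: (i9 i v ih).
by case: eqP => // -[ih']; move: vL; rewrite ih' take_size => /mem_take.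
Qed.

Lemma run_init_search t s : ok n s -> matching_inv (memory s) ->
  run n W init_search (fun t' s' => exists q,
    [/\ search_inv q 0 n (reg s' 11) (memory s'), reg s' 8 = size q,
      reg s' 7 = 0, mates (memory s') =1 mates (memory s)
      & t' <= t + 60 * n + 20]) t s.
Proof.
move=> oks inv; apply: run_seq; apply: run_straight => //=; split=> // ok1.
apply: run_seq.
pose qs k := [seq u <- iota 0 k | cell (memory s) 4 u == 0].
pose I k t' s' := [/\ reg s' 8 = size (qs k),
  forall i, i < k -> cell (memory s') 6 i = 0,
  forall i, i < size (qs k) -> cell (memory s') 7 i = nth 0 (qs k) i,
  forall k i, 1 < k < 6 -> cell (memory s') k i = cell (memory s) k i
  & t' <= t + 10 + 60 * k].
apply: (run_for n_gt0 W_large (I := I) (N := n)) => //=.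
- by split=> //; lia.
- move=> k t2 s2 ok2 kn r24 _ [r28 h6 h7 hk t2t].
  have qS : qs k.+1 = if cell (memory s) 4 k == 0 then rcons (qs k) k else qs k.
    by rewrite /qs -[k.+1]addn1 iotaD filter_cat /=; case: ifP; rewrite ?cats1 ?cats0.
  have sq : size (qs k) <= k by rewrite size_filter -{2}(size_iota 0 k) count_size.
  apply: run_straight => //=; split=> //; rewrite r24 r28 cell_eq //= hk //.
  split=> c4.
    rewrite (negbTE c4) in qS; split=> //; split=> //; last by lia.
    + by rewrite qS.
    + move=> i; rewrite /= cell_eq //= ltnS leq_eqVlt.
      by case: eqP => //= _ ik; exact: h6.
    + by move=> i; rewrite qS /= cell_eq //=; exact: h7.
    + by case=> [|[|[|[|[|[|k']]]]]] // i k6; rewrite /= cell_eq //=; exact: hk.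
  rewrite c4 eqxx in qS; split; first by rewrite /maxval; lia.
  split; first by rewrite /maxval; lia.
  split=> //; split=> //; last by lia.
  + by rewrite qS size_rcons addn1.
  + move=> i; rewrite /= !cell_eq //= ltnS leq_eqVlt.
    by case: eqP => //= _ ik; exact: h6.
  + move=> i; rewrite qS size_rcons /= !cell_eq //= ltnS nth_rcons.
    by case: ltngtP => // ik _; exact: h7.
  + by case=> [|[|[|[|[|[|k']]]]]] // i k6; rewrite /= !cell_eq //=; exact: hk.
- move=> t2 s2 ok2 [r28 h6 h7 hk t2t] _; apply: run_straight => //=.
  split=> //; split=> //; exists (qs n); split=> //; last by lia.
    split=> //.
    + exact: matching_inv_frame inv.
    + by rewrite filter_uniq ?iota_uniq.
    + by move=> u; rewrite mem_filter mem_iota => /andP [].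
    + move=> u un; rewrite /= mem_filter mem_iota un leq0n !andbT hk //.
      split=> [/eqP u4|[->|[v [vn _]]]] //; [by left|by rewrite h6].
    + by move=> v vn; rewrite h6.
    + move=> u v; rewrite mem_filter => /andP [/eqP u4 _] vn.
      by rewrite hk // u4.
    + by move=> _ v vn; rewrite h6.
  by move=> i; rewrite /mates hk.
Qed.

Lemma run_scan q h t s : ok n s -> h < size q ->
  search_inv q h.+1 0 (reg s 11) (memory s) ->
  reg s 9 = nth 0 q h -> reg s 8 = size q -> reg s 7 = h.+1 ->
  run n W scan (fun t' s' => exists q',
    [/\ search_inv q' h.+1 n (reg s' 11) (memory s'), reg s' 8 = size q',
      reg s' 7 = h.+1, mates (memory s') =1 mates (memory s) &
      take h.+1 q' = take h.+1 q /\ t' <= t + 30 + 100 * size (L (nth 0 q h))]) t s.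
Proof.
move=> oks hq inv r9 r8 r7; set u := nth 0 q h in r9 *.
have un : u < n by apply: (si_lt inv); exact: mem_nth.
pose I j t' s' := exists q', [/\ search_inv q' h.+1 j (reg s' 11) (memory s'),
  reg s' 8 = size q' /\ reg s' 9 = u,
  reg s' 7 = h.+1, mates (memory s') =1 mates (memory s) &
  take h.+1 q' = take h.+1 q /\ t' <= t + 10 + 100 * j].
have sizeL s' f q' k : search_inv q' h.+1 k f (memory s') -> reg s' 9 = u ->
    cell (memory s') 3 (reg s' 9) = size (L u).
  by move=> inv' ->; have [] := mi_lists (si_matching inv') un.
apply: (run_for n_gt0 W_large (I := I) (N := size (L u))) => //=.
- exact: sizeL inv r9.
- by exists q; split=> //; split=> //; lia.
- move=> j t2 s2 ok2 jl r210 sz [q' [inv2 [r28 r29] r27 m2 [th t2t]]].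
  have hq' : h < size q' by exact: (si_head inv2).
  have uE : nth 0 q' h = u.
    by rewrite -(nth_take 0 (ltnSn h)) th nth_take.
  have jl' : j < size (L (nth 0 q' h)) by rewrite uE.
  have [_ /(_ j jl) Lj] := mi_lists (si_matching inv2) un.
  set v := nth 0 (L u) j in Lj.
  have vn : v < n by apply: (@L_lt u); exact: mem_nth.
  have le5 := mi_le5 (si_matching inv2) vn.
  have szq := size_queue (si_uniq inv2) (fun y => si_lt inv2 (u := y)).
  have vE : nth 0 (L (nth 0 q' h)) j = v by rewrite uE.
  have sz' : cell (memory s2) 3 u = size (L u) by rewrite -sz r29.
  apply: run_straight => //=; rewrite r29 r210 Lj; split; first by rewrite /maxval; lia.
  rewrite !cell_eq //=; split=> v6.
    have inv3 := visit_old inv2 jl'; rewrite vE in inv3; have {}inv3 := inv3 v6.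
    split=> //.
    by exists q'; split=> //; split=> //; lia.
  split; first by rewrite /maxval; lia.
  rewrite r28; split=> v5.
    split; first by rewrite /maxval; lia.
    split; first by rewrite /maxval; lia.
    have v5' : cell (memory s2) 5 v = (cell (memory s2) 5 v - 1).+1 by lia.
    set w := cell (memory s2) 5 v - 1 in v5' *.
    pose M' := memory (set_mem (set_mem s2 (n * n + (8 * v + 6)) (u + 1))
      (n * n + (8 * size q' + 7)) w).
    have inv3 : search_inv (rcons q' w) h.+1 j.+1 (reg s2 11) M'.
      apply: (visit_matched L_lt inv2 jl') => //; rewrite ?vE // uE => k i /andP [_ k8].
      by rewrite /M' /= !cell_eq // addn1.
    split=> //.
    exists (rcons q' w); split=> //=.
    + by rewrite size_rcons addn1.
    + by move=> i; rewrite /mates /M' /= !cell_eq //=; exact: m2.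
    + by split; [rewrite -cats1 takel_cat // | lia].
  split; first by rewrite /maxval; lia.
  pose M' := memory (set_mem s2 (n * n + (8 * v + 6)) (u + 1)).
  have inv3 : search_inv q' h.+1 j.+1 v.+1 M'.
    rewrite -vE; apply: (visit_unmatched n_gt0 L_lt inv2 jl') => //; rewrite ?vE //.
    rewrite uE => k i /andP [_ k8].
    by rewrite /M' /= !cell_eq // addn1.
  split=> //.
  exists q'; split=> //=; first by rewrite addn1.
  + by move=> i; rewrite /mates /M' /= !cell_eq //=; exact: m2.
  + by split=> //; lia.
- move=> t2 s2 ok2 [q' [inv2 [r28 r29] r27 m2 [th t2t]]].
  exists q'; split=> //; last by split=> //; lia.
  apply: search_inv_row.
  by rewrite -(nth_take 0 (ltnSn h)) th nth_take.
Qed.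

Definition list_total := \sum_(0 <= u < n) size (L u).

(** A queue without repetitions scans each list at most once; this gives the O(n + m) bound for a
    search. *)
Lemma sum_queue (q : seq nat) : uniq q -> (forall u, u \in q -> u < n) ->
  \sum_(u <- q) size (L u) <= list_total.
Proof.
move=> uq qn; apply: (uniq_sub_le_big leqnn (fun x y => leq_addr y x)) => //.
  exact: iota_uniq.
by move=> u /qn un; rewrite mem_index_iota.
Qed.

Lemma run_search q t s : ok n s ->
  search_inv q 0 n (reg s 11) (memory s) -> reg s 8 = size q -> reg s 7 = 0 ->
  run n W search (fun t' s' => exists q',
    [/\ search_inv q' (size q') n (reg s' 11) (memory s'),
      mates (memory s') =1 mates (memory s) &
      t' <= t + 10 + 60 * n + 100 * list_total]) t s.
Proof.
move=> oks inv r8 r7.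
pose I k t' s' := exists q' h, [/\ search_inv q' h n (reg s' 11) (memory s'),
  reg s' 8 = size q', reg s' 7 = h, mates (memory s') =1 mates (memory s) &
  k = n - h /\ t' <= t + 60 * h + 100 * \sum_(u <- take h q') size (L u)].
apply: (run_while n_gt0 W_large (I := I) (k := n)) => //=.
- exists q, 0; split=> //; rewrite take0 big_nil subn0; split=> //; lia.
- move=> k t1 s1 ok1 [q1 [h [inv1 r18 r17 m1 [kE t1t]]]]; rewrite r17 r18.
  case: ltnP => // hq _.
  have szq := size_queue (si_uniq inv1) (fun y => si_lt inv1 (u := y)).
  apply: run_seq; apply: run_straight => //=; rewrite r17 (si_queue inv1) //.
  have un : nth 0 q1 h < n by apply: (si_lt inv1); exact: mem_nth.
  split=> [|ok2]; first by rewrite /maxval; lia.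
  apply: run_seq; apply: run_straight => //=; rewrite r17.
  split=> [|ok3]; first by rewrite /maxval; lia.
  have inv3 := search_inv_dequeue hq inv1.
  apply: (run_weaken _ (run_scan _ ok3 hq _ _ _ _)) => //=; last by rewrite addn1.
  move=> t4 s4 ok4 [q4 [inv4 r48 r47 m4 [th t4t]]].
  exists (n - h.+1); first by lia.
  exists q4, h.+1; split=> //; first by move=> i; rewrite m4 m1.
  split=> //; rewrite th (take_nth 0) // -cats1 big_cat big_seq1 /=; lia.
- move=> k t1 s1 ok1 [q1 [h [inv1 r18 r17 m1 [kE t1t]]]]; rewrite r17 r18.
  case: ltnP => // hq _.
  have hE : h = size q1 by apply/eqP; rewrite eqn_leq hq (si_head inv1).
  exists q1; split=> //; first by rewrite -hE.
  have szq := size_queue (si_uniq inv1) (fun y => si_lt inv1 (u := y)).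
  have := sum_queue (si_uniq inv1) (fun y => si_lt inv1 (u := y)).
  by rewrite hE take_size in t1t; lia.
Qed.

End ComputeMatching.

(** * Augmentation *)

Section Augmentation.
Variables n W : nat.
Local Notation cell M k i := (M (n * n + (8 * i + k))).
Hypothesis n_gt0 : 0 < n.
Hypothesis W_large : forall c d, c <= 1000 -> d <= 1000 -> c * n ^ d <= W.
Variable L : nat -> seq nat.
Hypothesis L_lt : forall w v, v \in L w -> v < n.
Hypothesis L_size : forall w, size (L w) <= n.
Local Notation search_inv := (search_inv n L).
Local Notation matching_inv := (matching_inv n L).
Local Notation list_total := (list_total n L).

Definition nmatched (M : nat -> nat) := \sum_(i < n) (cell M 4 i != 0).

Lemma nmatched_le M : nmatched M <= n.
Proof.
apply: leq_trans (_ : \sum_(i < n) 1 <= n); last by rewrite sum1_card card_ord.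
by apply: leq_sum => i _; exact: leq_b1.
Qed.

(** Giving [u] a new mate raises the count exactly when [u] was unmatched, which on an augmenting
    path happens only at its root. *)
Lemma nmatched_set (M M' : nat -> nat) u : u < n ->
  (forall i, i != u -> cell M' 4 i = cell M 4 i) -> cell M' 4 u != 0 ->
  nmatched M' + (cell M 4 u != 0) = (nmatched M).+1.
Proof.
move=> un E u0; rewrite /nmatched (bigD1 (Ordinal un)) //= u0.
rewrite [in RHS](bigD1 (Ordinal un)) //= addnAC add1n addSn; congr (_ + _).+1.
by apply: eq_bigr => i iu; rewrite E.
Qed.

(* [m0] is the matching before the augmentation; [f] is zero or one plus the
   lower element that is to be matched next with its predecessor. *)
Record flip_inv (q : seq nat) (m0 : nat -> nat) (f : nat) (M : nat -> nat) : Prop :=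
 FlipInv {
  fi_lists : lists n L M;
  fi_le4 : forall u, u < n -> cell M 4 u <= n;
  fi_le5 : forall v, v < n -> cell M 5 v <= n;
  fi_edge : forall u v, u < n -> cell M 4 u = v.+1 -> v \in L u;
  fi_mate : forall u v, u < n -> v < n -> v.+1 <> f ->
    cell M 4 u = v.+1 <-> cell M 5 v = u.+1;
  fi_lt : forall u, u \in q -> u < n;
  fi_pred : forall v, v < n -> cell M 6 v != 0 ->
    exists u, [/\ u \in q, cell M 6 v = u.+1 & v \in L u];
  fi_rank : forall u v, u \in q -> v < n -> m0 u = v.+1 ->
    exists u', cell M 6 v = u'.+1 /\ index u' q < index u q;
  fi_front : forall v, f = v.+1 ->
    [/\ v < n, cell M 6 v != 0 & forall u, u < n -> cell M 4 u != v.+1];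
  fi_orig : forall v u w, f = v.+1 -> cell M 6 v = u.+1 -> w \in q ->
    index w q <= index u q -> cell M 4 w = m0 w }.

Definition flip_rank (q : seq nat) f (M : nat -> nat) :=
  if f is v.+1 then (index (cell M 6 v).-1 q).+1 else 0.

Lemma flip_inv_init q f M : search_inv q (size q) n f M ->
  flip_inv q (mates n M) f M.
Proof.
case=> [[i1 i2 i3 i4 i5] j2 j3 j4 j5 j6 j7 j8 j9 j10 j11]; split=> //.
- by move=> u v un vn _; exact: i2.
- by move=> v vn /(j7 v vn) [u]; rewrite take_size; exists u.
- move=> v /j11 [vn v6 v5]; split=> // u un.
  by apply/eqP => /(i2 u v un vn); rewrite v5.
Qed.

(** The old mate of [u] becomes the next vertex to be matched. Until then its entry in array 5 is
    stale, which is why [fi_mate] exempts it. Its predecessor comes before [u] in the queue, so no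
    vertex yet to be visited has been altered. *)
Lemma flip_step q m0 v u M M' : flip_inv q m0 v.+1 M -> cell M 6 v = u.+1 ->
  (forall k i, 1 < k < 7 -> cell M' k i =
    if (k == 5) && (i == v) then u.+1
    else if (k == 4) && (i == u) then v.+1 else cell M k i) ->
  flip_inv q m0 (cell M 4 u) M' /\
  flip_rank q (cell M 4 u) M' < flip_rank q v.+1 M.
Proof.
case=> i1 i2 i3 i4 i5 i6 i7 i8 i9 i10 vu E.
have [vn v6 vfree] := i9 v (erefl _).
have [u1 [uq u1E vL]] := i7 v vn v6; move: u1E; rewrite vu => -[u1E].
rewrite -{u1}u1E in uq vL.
have un := i6 u uq.
have E6 i : cell M' 6 i = cell M 6 i by rewrite E.
have E4u : cell M' 4 u = v.+1 by rewrite E //= eqxx.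
have E4 i : i != u -> cell M' 4 i = cell M 4 i.
  by move=> iu; rewrite E //= (negbTE iu).
have E5v : cell M' 5 v = u.+1 by rewrite E //= eqxx.
have E5 i : i != v -> cell M' 5 i = cell M 5 i.
  by move=> iv; rewrite E //= (negbTE iv).
(* By [fi_orig] the mate of [u] is still the original one, so [fi_rank], which speaks of the
   original matching, applies to it. *)
have um : cell M 4 u = m0 u by apply: (i10 v u u).
have next v' : cell M 4 u = v'.+1 -> v' < n /\
    exists u', [/\ u' \in q, cell M 6 v' = u'.+1 & index u' q < index u q].
  move=> uv'; have v'n : v' < n by apply: L_lt (i4 u v' un uv').
  have [u' [u'E lt]] := i8 u v' uq v'n (etrans (esym um) uv').
  split=> //; exists u'; split=> //; rewrite -index_mem.
  by apply: ltn_trans lt _; rewrite index_mem.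
split; last first.
  case u4: (cell M 4 u) => [|v'] //=; have [_ [u' [_ u'E lt]]] := next v' u4.
  by rewrite E6 u'E vu.
split=> //.
- by apply: lists_frame i1 => i; rewrite E.
- move=> y yn; have [->|yu] := eqVneq y u; first by rewrite E4u.
  by rewrite E4 //; exact: i2.
- move=> y yn; have [->|yv] := eqVneq y v; first by rewrite E5v.
  by rewrite E5 //; exact: i3.
- move=> y z yn; have [->|yu] := eqVneq y u; first by rewrite E4u => -[<-].
  by rewrite E4 //; exact: i4.
- move=> y z yn zn zf; have [->|yu] := eqVneq y u.
    rewrite E4u; have [->|zv] := eqVneq z v; first by rewrite E5v.
    rewrite E5 //; split=> [[vz]|/i5 zu]; first by rewrite vz eqxx in zv.
    by case: zf; rewrite zu // => -[vz]; rewrite vz eqxx in zv.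
  rewrite E4 //; have [->|zv] := eqVneq z v.
    rewrite E5v; split=> [yv|[uy]]; last by rewrite uy eqxx in yu.
    by have := vfree y yn; rewrite yv eqxx.
  rewrite E5 //; apply: i5 => // -[zv']; by rewrite zv' eqxx in zv.
- by move=> z zn; rewrite E6; exact: i7.
- by move=> y z yq zn yz; rewrite E6; exact: i8.
- move=> z uz; have [zn [u' [u'q u'E lt]]] := next z uz.
  have zv : z != v.
    by apply/eqP => zv; have := vfree u un; rewrite uz zv eqxx.
  split=> //; first by rewrite E6 u'E.
  move=> y yn; have [->|yu] := eqVneq y u.
    by rewrite E4u eqSS eq_sym.
  rewrite E4 //; apply: contra_neq yu => yz.
  have zf : z.+1 <> v.+1 by move=> [zv']; rewrite zv' eqxx in zv.
  have /(i5 y z yn zn zf) := yz; have /(i5 u z un zn zf) -> := uz.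
  by case.
- move=> z u' w uz; rewrite E6 => u'E wq le; have [_ [u2 [_ u2E lt]]] := next z uz.
  move: u2E; rewrite u'E => -[u2E]; rewrite -u2E in lt.
  have wu : w != u by apply: contraTneq le => ->; rewrite -ltnNge.
  by rewrite E4 //; apply: (i10 v u) => //; exact: leq_trans le (ltnW lt).
Qed.

(* The predecessors of the vertices on an augmenting path occur in the queue in
   decreasing order, which bounds the number of iterations. *)
Lemma run_flip q m0 t s : ok n s -> reg s 11 != 0 ->
  size q <= n -> flip_inv q m0 (reg s 11) (memory s) ->
  run n W flip (fun t' s' => [/\ matching_inv (memory s'),
    nmatched (memory s') = (nmatched (memory s)).+1, reg s' 12 = reg s 12
    & t' <= t + 80 * n + 20]) t s.
Proof.
move=> oks f0 qn inv.
pose I k t' s' := [/\ flip_inv q m0 (reg s' 11) (memory s'),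
  nmatched (memory s') = nmatched (memory s) + (reg s' 11 == 0),
  reg s' 12 = reg s 12, k = flip_rank q (reg s' 11) (memory s')
  & t' + 80 * k <= t + 80 * n].
have rank_le f M : flip_inv q m0 f M -> flip_rank q f M <= n.
  case: f => [|v] // inv'; have [vn v6 _] := fi_front inv' (erefl _).
  have [u [uq uE _]] := fi_pred inv' vn v6; rewrite /flip_rank uE.
  by apply: leq_trans qn; rewrite index_mem.
apply: (run_while n_gt0 W_large (I := I) (k := flip_rank q (reg s 11) (memory s))) => //=.
- by split=> //; [rewrite (negbTE f0) addn0 | have := rank_le _ _ inv; lia].
- move=> k t1 s1 ok1 [inv1 m1 r12 kE t1t] f1.
  case f1E: (reg s1 11) f1 inv1 kE m1 => [|v] // _ inv1 kE m1.
  have [vn v6 vfree] := fi_front inv1 (erefl _).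
  have [u [uq uE uL]] := fi_pred inv1 vn v6.
  have un := fi_lt inv1 uq; have le4 := fi_le4 inv1 un.
  apply: run_straight => //=; rewrite f1E subn1 /= uE subn1 /=.
  do 5 (split; [by rewrite /maxval; lia |]).
  set s2 := set_mem _ _ (u + 1).
  have E k' i : 1 < k' < 7 -> cell (memory s2) k' i =
      if (k' == 5) && (i == v) then u.+1
      else if (k' == 4) && (i == u) then v.+1 else cell (memory s1) k' i.
    by case/andP=> _ k7; rewrite /s2 /= !cell_eq ?addn1 // ltnW.
  have [inv2 lt] := flip_step inv1 uE E.
  exists (flip_rank q (cell (memory s1) 4 u) (memory s2)); first by rewrite kE.
  split=> //; last by rewrite kE in t1t; lia.
  have m2 : nmatched (memory s2) + (cell (memory s1) 4 u != 0) = (nmatched (memory s1)).+1.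
    by apply: nmatched_set => // [i iu|]; rewrite E //= ?(negbTE iu) // eqxx.
  have -> : reg s2 11 = cell (memory s1) 4 u by [].
  move: m2; rewrite m1 /= addn0 => m2.
  by move: m2; case: (cell (memory s1) 4 u == 0) => /=; lia.
- move=> k t1 s1 ok1 [inv1 m1 r12 kE t1t] f1; rewrite f1 eqxx in inv1 m1.
  split=> //; [|by rewrite m1 addn1|by lia].
  case: inv1 => i1 i2 i3 i4 i5 *; split=> //.
  by move=> u v un vn; exact: i5.
Qed.

(** What an unsuccessful search leaves behind: with the marked vertices as [Z], the last two fields
    provide [Z_closed] and [Z_matched] of the duality section. *)
Record optimal_inv (M : nat -> nat) : Prop := OptimalInv {
  oi_matching : matching_inv M;
  oi_closed : forall u v, u < n ->
    (cell M 4 u = 0 \/ exists v', [/\ v' < n, cell M 4 u = v'.+1 & cell M 6 v' != 0]) ->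
    v \in L u -> cell M 6 v != 0;
  oi_covered : forall v, v < n -> cell M 6 v != 0 -> cell M 5 v != 0 }.

Lemma search_inv_optimal q M : search_inv q (size q) n 0 M -> optimal_inv M.
Proof.
case=> i1 i2 i3 i4 i5 i6 i7 i8 i9 i10 i11; split=> //; last exact: i10.
move=> u v un /(i6 u un) uq vL; apply: (i9 (index u q)); rewrite ?index_mem //.
by rewrite if_same nth_index // take_oversize.
Qed.

Definition phase_time := 300 * n + 100 * list_total + 100.

Definition matching_time := phase_time * (n + 2) + 20.

(** The variant is one plus the number of unmatched vertices: each success matches one more, and the
    extra unit pays for the final failure. *)
Lemma run_compute_matching t s : ok n s -> matching_inv (memory s) ->
  run n W compute_matching (fun t' s' =>
    optimal_inv (memory s') /\ t' <= t + matching_time) t s.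
Proof.
move=> oks inv; apply: run_seq; apply: run_straight => //=.
split=> [|ok1]; first by rewrite /maxval; lia.
pose I k t' s' := [/\ if reg s' 12 == 0 then optimal_inv (memory s')
    else matching_inv (memory s'),
  k = (if reg s' 12 == 0 then 0 else (n - nmatched (memory s')).+1)
  & t' + phase_time * k <= t + 10 + phase_time * n.+1].
pose k0 := (n - nmatched (memory s)).+1.
apply: (run_while n_gt0 W_large (I := I) (k := k0)) => //=.
- split=> //=; have : phase_time * k0 <= phase_time * n.+1; last by lia.
  by rewrite leq_mul2l; apply/orP; right; rewrite ltnS leq_subr.
- move=> k t1 s1 ok2 [inv1 kE t1t] r12; rewrite (negbTE r12) in inv1 kE.
  apply: run_seq.
  apply: (run_weaken _ (run_init_search n_gt0 W_large _ _ inv1)) => //.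
  move=> t2 s2 ok3 [q [inv2 r28 r27 m2 t2t]] _; apply: run_seq.
  apply: (run_weaken _ (run_search n_gt0 W_large L_lt L_size _ ok3 inv2 r28 r27)).
  move=> t3 s3 ok4 [q3 [inv3 m3 t3t]] _; apply: run_seq; apply: run_straight => //=.
  have f_le : reg s3 11 <= n.
    by case f3: (reg s3 11) inv3 => [|v] // inv3; have [] := si_found inv3 (erefl _).
  have nm : nmatched (memory s3) = nmatched (memory s1).
    by apply: eq_bigr => i _; have := m3 i; rewrite m2 /mates => ->.
  split=> [|ok5]; first by rewrite /maxval; lia.
  have [f0|f0] := eqVneq (reg s3 11) 0.
    (* The search failed, so [flip] stops at its first test; [J] just records the unchanged
       state. *)
    pose J (k : nat) t' s' := t' = t3 + 2 /\ s' = set_reg s3 12 (reg s3 11).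
    apply: (run_while n_gt0 W_large (I := J) (k := 0)) => //=.
      by move=> k' t4 s4 _ [_ ->] /=; rewrite f0.
    move=> k' t4 s4 _ [-> ->] _; exists 0; first by rewrite kE.
    split=> /=; rewrite ?f0 //=; first by apply: search_inv_optimal; rewrite -f0; exact: inv3.
    rewrite muln0; apply: leq_trans t1t; rewrite kE mulnS.
    set A := phase_time * (n - _); rewrite /phase_time; lia.
  have szq := size_queue (si_uniq inv3) (fun y => si_lt inv3 (u := y)).
  apply: (run_weaken _ (run_flip _ ok5 _ szq (flip_inv_init inv3))) => //=.
  move=> t4 s4 ok6 [inv4 nm4 r412 t4t].
  have := nmatched_le (memory s4); rewrite nm4 nm => lt.
  exists (n - nmatched (memory s1)); first by rewrite kE.
  rewrite /= in r412; split; rewrite ?r412 ?(negbTE f0) //; first by rewrite nm4 nm subnSK.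
  apply: leq_trans t1t; rewrite kE mulnS.
  by set A := phase_time * (n - _); rewrite /phase_time; lia.
- move=> k t1 s1 ok2 [inv1 kE t1t] r12; rewrite r12 eqxx in inv1.
  split=> //; rewrite /matching_time [n + 2]addn2 mulnS.
  by have := leq_trans (leq_addr _ _) t1t; set A := phase_time * n.+1; lia.
Qed.
End Augmentation.

(** * Output and correctness *)

(** The output overwrites only the start of the adjacency matrix, below all the arrays read here.
    For an unmatched vertex the truncated subtraction reads the mark of vertex 0, which is harmless
    because the other summand is already 1. *)
Definition write_output : cmd :=
  For 4 (Reg 0)
    (If (Cell 6 (Reg 4)) (SetMem (Reg 4) (Lit 0))
      (SetMem (Reg 4) (Op Add (Op Eq (Cell 4 (Reg 4)) (Lit 0))
        (Op Lt (Lit 0) (Cell 6 (Op Defs.Sub (Cell 4 (Reg 4)) (Lit 1))))))).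

Definition solve : cmd :=
  Seq (SetMem (addr 0 (Reg 1)) (Lit 1))
  (Seq compute_order (Seq compute_lists (Seq compute_matching write_output))).

(** The first command is kept apart because the program logic presupposes [n * n] in register 2. *)
Definition program : cmd := Seq (SetReg 2 (Op Mul (Reg 0) (Reg 0))) solve.

Section Output.
Variables n W : nat.
Local Notation cell M k i := (M (n * n + (8 * i + k))).
Hypothesis n_gt0 : 0 < n.
Hypothesis W_large : forall c d, c <= 1000 -> d <= 1000 -> c * n ^ d <= W.

Definition output_cell (M : nat -> nat) v :=
  (cell M 6 v == 0) && ((cell M 4 v == 0) || (cell M 6 (cell M 4 v).-1 != 0)).

Lemma run_write_output t s : ok n s ->
  run n W write_output (fun t' s' =>
    (forall v, v < n -> (memory s' v != 0) = output_cell (memory s) v) /\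
    t' <= t + 100 * n + 10) t s.
Proof.
move=> oks.
pose I k t' s' := [/\ forall a, n <= a -> memory s' a = memory s a,
  forall v, v < k -> (memory s' v != 0) = output_cell (memory s) v
  & t' <= t + 2 + 100 * k].
apply: (run_for n_gt0 W_large (I := I) (N := n)) => //=.
- by split=> //; lia.
- move=> k t1 s1 ok1 kn r4 _ [hi lo t1t].
  have cellE k' i : cell (memory s1) k' i = cell (memory s) k' i.
    by apply: hi; apply: leq_trans (leq_addr _ _); exact: leq_pmulr.
  have step b : (b != 0) = output_cell (memory s) k ->
      forall v, v < k.+1 ->
      ((if v == k then b else memory s1 v) != 0) = output_cell (memory s) v.
    move=> bE v; rewrite ltnS leq_eqVlt; case: (v =P k) => [->|_] //= vk.
    exact: lo.
  have high b a : n <= a -> (if a == k then b else memory s1 a) = memory s a.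
    by move=> na; rewrite gtn_eqF ?hi //; exact: leq_trans na.
  apply: run_straight => //=; rewrite r4 !cellE; split=> c6.
    split=> //; split=> //; split=> //=; [exact: high| |by lia].
    by apply: step; rewrite /output_cell (negbTE c6).
  split; first by rewrite /maxval; case: (_ == _); case: (_ < _) => /=; lia.
  split=> //; split=> //=; [exact: high| |by lia].
  apply: step; rewrite /output_cell c6 eqxx /= subn1 addn_eq0 negb_and.
  by rewrite !eqb0 negbK lt0n negbK.
- by move=> t1 s1 ok1 [_ lo t1t]; split=> //; lia.
Qed.

End Output.

(** * Transfer from vertices to plain numbers *)

Section Lift.
Variable n : nat.

Definition lift_rel (r : rel 'I_n) : rel nat := fun u v =>
  if insub u is Some i then if insub v is Some j then r i j else false else false.

Definition lift_fun (g : 'I_n -> nat) (u : nat) :=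
  if insub u is Some i then g i else 0.

Lemma lift_relE r (i j : 'I_n) : lift_rel r i j = r i j.
Proof. by rewrite /lift_rel !valK. Qed.

Lemma lift_funE g (i : 'I_n) : lift_fun g i = g i.
Proof. by rewrite /lift_fun valK. Qed.

Lemma lift_ordP u : u < n -> exists i : 'I_n, u = i.
Proof. by move=> un; exists (Ordinal un). Qed.
End Lift.

(** * Correctness and running time for a given graph *)

Section Correctness.
Variables (n W : nat) (e : rel 'I_n) (x : 'I_n).
Local Notation cell M k i := (M (n * n + (8 * i + k))).
Hypothesis W_large : forall c d, c <= 1000 -> d <= 1000 -> c * n ^ d <= W.
Hypotheses (e_sym : symmetric e) (e_irr : irreflexive e).
Hypothesis e_conn : forall u v, connect e u v.

Let n_gt0 : 0 < n.
Proof. exact: leq_ltn_trans (ltn_ord x). Qed.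

Let adj := lift_rel e.
Let D := lift_fun (level e x).
Let bel := lift_rel (below e x).
Let L := lower n bel.
Let m := #|edge_set (star_graph e x)|.

Let dagE (i j : 'I_n) : dag adj D i j = down_edge e x i j.
Proof. by rewrite /dag /adj /D lift_relE !lift_funE. Qed.

Let L_lt w v : v \in L w -> v < n.
Proof. by rewrite mem_filter mem_iota => /andP []. Qed.

Let L_size w : size (L w) <= n.
Proof. by rewrite size_filter -{2}(size_iota 0 n) count_size. Qed.

Let memL (w z : 'I_n) : (nat_of_ord z \in L w) = below e x z w.
Proof. by rewrite mem_filter mem_iota /= add0n ltn_ord andbT /bel lift_relE. Qed.

Let list_total_le : list_total n L <= m.
Proof.
apply: leq_trans (card_below_le x e_sym e_conn).
rewrite /list_total big_mkord; apply: leq_sum => w _.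
rewrite cardE -(size_map (@nat_of_ord n)); apply: uniq_leq_size.
  by rewrite filter_uniq ?iota_uniq.
move=> z zL; have [i zi] := lift_ordP (L_lt zL); rewrite zi in zL *.
by rewrite mem_map ?mem_enum ?inE -?memL //; exact: val_inj.
Qed.

Let children_le : \sum_(0 <= v < n) children n adj D v <= m.
Proof.
apply: leq_trans (card_below_le x e_sym e_conn).
rewrite big_mkord (eq_bigr (fun v : 'I_n => \sum_(w < n) dag adj D v w)); last first.
  by move=> v _; rewrite /children big_mkord.
rewrite exchange_big /=; apply: leq_sum => w _.
rewrite -sum1_card [X in _ <= X]big_mkcond /=; apply: leq_sum => v _.
rewrite inE dagE; case: ifP => [_|nb]; first exact: leq_b1.
rewrite leqn0 eqb0; apply: contraFN nb => vw.
by apply/belowP; exists v; split=> //; left.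
Qed.

(** Array 4 is read as a matching and array 6 as Koenig's set. The number of unmatched vertices then
    lies between the size of any position set and the size of the output. *)
Lemma optimal_inv_output M M' : optimal_inv n L M ->
  (forall v, v < n -> (M' v != 0) = output_cell n M v) ->
  maximum_position_set e x [set v : 'I_n | M' v != 0].
Proof.
case=> [[_ mate le4 le5 edge] closed covered] outE.
pose f (w : 'I_n) : option 'I_n := if cell M 4 w is v.+1 then insub v else None.
pose Z := [set v : 'I_n | cell M 6 v != 0].
have fE w z : f w = Some z <-> cell M 4 w = z.+1.
  rewrite /f; case: (cell M 4 w) => [|v] //; split=> [|[->]]; last by rewrite valK.
  by case: insubP => // u _ <- [->].
have fN w : f w = None <-> cell M 4 w = 0.
  rewrite /f; case E: (cell M 4 w) => [|v] //; split=> //.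
  case: insubP => // /negP []; have := le4 w (ltn_ord w); by rewrite E.
have f_below w z : f w = Some z -> below e x z w.
  by move/fE/(edge w z (ltn_ord w)); rewrite memL.
have f_inj w w' z : f w = Some z -> f w' = Some z -> w = w'.
  move/fE/(mate w z (ltn_ord w) (ltn_ord z)) => E.
  move/fE/(mate w' z (ltn_ord w') (ltn_ord z)); rewrite E => -[ww'].
  exact: val_inj.
pose ZL := [set w | if f w is Some z then z \in Z else true].
have Z_matched z : z \in Z -> exists w, f w = Some z.
  rewrite inE => /(covered z (ltn_ord z)); case E: (cell M 5 z) => [|w] // _.
  have wn : w < n by rewrite -E; exact: le5.
  exists (Ordinal wn); apply/fE; exact/(mate (Ordinal wn) z wn (ltn_ord z)).
have Z_closed w z : w \in ZL -> below e x z w -> z \in Z.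
  rewrite !inE -memL => wZL; apply: (closed w z (ltn_ord w)).
  case E: (f w) wZL => [v|] wZL; last by left; apply/fN.
  by rewrite inE in wZL; right; exists v; split=> //; apply/fE.
have outS : [set v : 'I_n | M' v != 0] = ZL :\: Z.
  apply/setP => v; rewrite !inE outE // /output_cell negbK; congr (_ && _).
  case E: (f v) => [z|]; last by move/fN: E => ->.
  by move/fE: E => ->; rewrite inE.
rewrite outS; split.
  by apply/(position_setP _ e_conn); exact: koenig_antichain Z_closed.
move=> S' /(position_setP _ e_conn) anti.
apply: leq_trans (antichain_le_unmatched (@below_trans _ e x) f_below f_inj anti) _.
exact: koenig_card Z_matched.
Qed.

Lemma run_solve s : ok n s -> reg s 1 = x ->
  (forall i, memory s i =
    [exists u : 'I_n, exists v : 'I_n, (i == u * n + v) && e u v]) ->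
  run n W solve (fun t' s' => maximum_position_set e x (output n s') /\
    (1 < n -> t' <= 3000 * (n * m))) 20 s.
Proof.
move=> oks r1 memE.
have adjs : adjacency n adj (memory s).
  move=> u v un vn; rewrite memE; congr nat_of_bool.
  have [i ui] := lift_ordP un; have [j vj] := lift_ordP vn.
  rewrite ui vj /adj lift_relE; apply/existsP/idP => [[i' /existsP [j']]|ij].
    by rewrite idx_eq // => /andP [/andP [/eqP/val_inj -> /eqP/val_inj ->]].
  by exists i; apply/existsP; exists j; rewrite eqxx.
have zeros k i : cell (memory s) k i = 0.
  rewrite memE; apply/eqP; rewrite eqb0; apply/existsPn => u; apply/existsPn => v.
  by rewrite eq_sym adj_cell_eq.
have Dx : D x = 0 by rewrite /D lift_funE level_root.
have D_lt v : v < n -> D v < n.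
  move=> /lift_ordP [i ->]; rewrite /D lift_funE.
  by have := level_lt x e_conn i; rewrite card_ord.
have D_edge u v : u < n -> v < n -> adj u v -> D v <= (D u).+1.
  move=> /lift_ordP [i ->] /lift_ordP [j ->]; rewrite /adj lift_relE /D !lift_funE.
  exact: level_edge.
have D_parent v : v < n -> v != x -> exists2 u, u < n & dag adj D u v.
  move=> /lift_ordP [i ->] ix; have [u ui] := level_parent e_conn ix.
  by exists u => //; rewrite dagE.
have belE z w : z < n -> w < n ->
    bel z w <-> exists u, [/\ u < n, dag adj D u w & z = u \/ bel z u].
  move=> /lift_ordP [i ->] /lift_ordP [j ->]; rewrite /bel lift_relE; split.
    move/belowP => [u [uj iu]]; exists u; rewrite dagE lift_relE; split=> //.
    by case: iu => [->|]; [left|right].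
  case=> u [/lift_ordP [k ->]]; rewrite dagE lift_relE => kj ik.
  by apply/belowP; exists k; split=> //; case: ik => [/val_inj|]; [left|right].
have r1' : ev n s (Reg 1) = x by rewrite -r1.
apply: run_seq; apply: run_straight => //=; rewrite r1.
split=> [|ok1]; first by rewrite /maxval; lia.
apply: run_seq; apply: (run_weaken _ (run_compute_order n_gt0 W_large (ltn_ord x) Dx
  D_lt D_edge D_parent belE _ ok1 _ _)) => //=; last first.
- move=> k i k8; rewrite cell_eq // zeros. by case: (_ && _).
- by move=> u v un vn; rewrite /= adj_cell_eq // adjs.
move=> t2 s2 ok2 [hb hz t2t] _; apply: run_seq.
apply: (run_weaken _ (run_compute_lists n_gt0 W_large _ ok2 hb hz)).
move=> t3 s3 ok3 [hl hz3 t3t] _; apply: run_seq.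
have inv3 : matching_inv n L (memory s3).
  split=> // [u v un vn|u un|v vn|u v un]; rewrite ?hz3 //.
apply: (run_weaken _ (run_compute_matching n_gt0 W_large L_lt L_size _ ok3 inv3)).
move=> t4 s4 ok4 [opt t4t] _.
apply: (run_weaken _ (run_write_output n_gt0 W_large _ ok4)).
move=> t5 s5 ok5 [out t5t]; split; first exact: optimal_inv_output opt out.
move=> n1; have m0 := card_pred_le x e_sym e_conn; rewrite card_ord -/m in m0.
have mn : n <= m + 1 by lia.
have m1 : 0 < m by lia.
have := children_le; have := list_total_le.
move: t2t t3t t4t; rewrite /order_time /lists_time /matching_time /phase_time.
set A := \sum_(0 <= v < n) _; set B := list_total n L => t2t t3t t4t Bm Am.
have nA : n * A <= n * m by rewrite leq_mul2l Am orbT.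
have nB : n * B <= n * m by rewrite leq_mul2l Bm orbT.
(* For [n > 1] we have [m > 0], so [n <= m + 1 <= 2 * m]. *)
have nn : n * n <= 2 * (n * m) by rewrite mulnCA leq_mul2l; lia.
have nm : n <= n * m by rewrite leq_pmulr.
(* The number of phases is absorbed by [n + 2 <= 2 * n], valid for [n > 1]. *)
have e3 : (300 * n + 100 * B + 100) * (n + 2) <=
    600 * (n * n) + 200 * (n * B) + 200 * n.
  rewrite (_ : 600 * (n * n) + _ + _ = (300 * n + 100 * B + 100) * (n * 2)); last first.
    by lia.
  by rewrite leq_mul2l; apply/orP; right; lia.
move: (leq_trans t4t (leq_add (leqnn t3) (leq_add e3 (leqnn 20)))) => {e3}t4t'.
rewrite -!mulnA in t2t t3t.
(* Once the products are abstracted to variables, the remaining estimate is linear. *)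
set P := n * m in nA nB nn nm *; set NA := n * A in nA t2t; set NB := n * B in nB t4t'.
set NN := n * n in nn t2t t3t t4t'.
clearbody P NA NB NN; clear -nA nB nn nm n1 t2t t3t t4t' t5t; lia.
Qed.

End Correctness.

Lemma run_program n W (e : rel 'I_n) (x : 'I_n) :
  (forall c d, c <= 1000 -> d <= 1000 -> c * n ^ d <= W) ->
  symmetric e -> irreflexive e -> (forall u v, connect e u v) ->
  exists t s, [/\ exec W program (input e x) t s,
    maximum_position_set e x (output n s) &
    1 < n -> t <= 3020 * (n * #|edge_set (star_graph e x)|)].
Proof.
move=> W_large e_sym e_irr e_conn.
have n_gt0 : 0 < n by exact: leq_ltn_trans (ltn_ord x).
have nW : n * n < W.
  by apply: leq_trans (W_large 2 2 _ _) => //; rewrite -mulnn; have := leq_mul n_gt0 n_gt0; lia.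
have nW' : n < W by apply: leq_ltn_trans nW; exact: leq_pmulr.
set s1 := set_reg (input e x) 2 (n * n).
have ex1 : exec W (SetReg 2 (Op Mul (Reg 0) (Reg 0))) (input e x) 4 s1.
  by apply: ExecSetReg => /=; rewrite /word nW' /= nW.
have ok1 : ok n s1.
  split=> // [r|i] /=.
    case: (r == 2); first by rewrite /maxval; lia.
    case: r => [|[|r]] /=; rewrite ?nth_nil /maxval; try lia.
    by have := ltn_ord x; lia.
  by rewrite /maxval; case: [exists _, _] => /=; lia.
have [t [s [ex2 ok2 [max time]]]] :=
  run_solve W_large e_sym e_conn ok1 (erefl _) (fun _ => erefl _).
exists (4 + t), s; split=> //; first exact: ExecSeq ex1 ex2.
move=> n1; have := time n1; have m0 := card_pred_le x e_sym e_conn.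
rewrite card_ord in m0; set m := #|edge_set (star_graph e x)| in m0 *.
have mn : 0 < n * m by rewrite muln_gt0 n_gt0; case: (n) n1 m0 => [|[|k]] // _; case: (m).
move: mn; set P := n * m; clearbody P; clear; lia.
Qed.

(** * The bound with the logarithmic factor *)

Import Order.TTheory GRing.Theory Num.Theory.
Local Open Scope ring_scope.

Theorem theorem5p7 (R : realType) :
  exists (P : cmd) (c : nat) (C : R),
  forall (n : nat) (e : rel 'I_n) (x : 'I_n),
    symmetric e -> irreflexive e -> (forall u v : 'I_n, connect e u v) ->
    let m := #|edge_set (star_graph e x)| in
    exists (t : nat) (s : state),
      [/\ exec (word_bound c n) P (input e x) t s,
          maximum_position_set e x (output n s)
        & (1 < n)%N ->
          t%:R <= C * (n%:R * m%:R * ln (n%:R ^+ 2 / m%:R))].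
Proof.
have ln2 : 0 < ln (2%:R : R) by rewrite ln_gt0 // ltr1n.
(* Dividing by [ln 2] is paid for by the logarithmic factor, which is at least [ln 2] because
   [2 * m <= n ^ 2]. *)
exists program, 1000%N, (3020%:R / ln 2%:R) => n e x e_sym e_irr e_conn m.
have W_large a b : (a <= 1000 -> b <= 1000 -> a * n ^ b <= word_bound 1000 n)%N.
  by move=> a1 b1; apply: leq_coef => //; exact: leq_ltn_trans (ltn_ord x).
have [t [s [ex max time]]] := run_program x W_large e_sym e_irr e_conn.
exists t, s; split=> // n1; rewrite -/m in time.
have m_gt0 : (0 < m)%N.
  have := card_pred_le x e_sym e_conn; rewrite card_ord -/m.
  by apply: leq_trans; rewrite -subn1 subn_gt0.
have ratio : 2%:R <= n%:R ^+ 2 / m%:R :> R.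
  rewrite ler_pdivlMr ?ltr0n // -natrX -natrM ler_nat mul2n.
  by have := card_star_le x e_irr; rewrite card_ord.
apply: (@le_trans _ _ (3020%:R * (n%:R * m%:R))).
  by rewrite -!natrM ler_nat; exact: time.
rewrite -[leRHS]mulrA ler_wpM2l ?ler0n // mulrCA ler_peMr ?mulr_ge0 ?ler0n //.
rewrite mulrC ler_pdivlMr // mul1r ler_ln ?posrE //.
exact: lt_le_trans ratio.
Qed.
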